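(* Let $c>0$ and let $(w-a)(w-b)$ be a real quadratic polynomial ($a,b\in\mathbb{C}$ with $a+b,\,ab\in\mathbb{R}$), where it is assumed that, for a suitable real constant $N\neq0$, $Q(t)=N(t-a)(t-b)>0$ for $-2\sqrt c<t<2\sqrt c$, and that $a=b=\pm2\sqrt c$ does not occur. Let $\mu(dt)=\frac{\sqrt{4c-t^2}}{Q(t)}\,dt$ on $[-2\sqrt c,2\sqrt c]$, with $N$ chosen so that $\mu$ is a probability measure, and let $S_\mu(w)=\int\frac{1}{t-w}\,\mu(dt)$ be its Stieltjes transform. Then: 1. There exists exactly one positive solution $(\alpha,\beta)$ which satisfies $S_{\alpha,\beta}=S_\mu$. 2. For imaginary (i.e. non-real) roots $a,b$, there is no other positive solution. 3. For real roots $a,b$, there is one more positive solution if $ab>0$, whereas there are three positive solutions other than the one giving $S_\mu$ if $ab<0$. 4. Thus atomic measures appear for these extra solutions.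
   Context: Let $\rho(w)=\frac{-w+\sqrt{w^2-4c}}{2}$, with $\sqrt{w^2-4c}$ the analytic branch on $\mathbb{C}\setminus[-2\sqrt c,2\sqrt c]$ behaving like $w$ at infinity. For parameters $\alpha$ and $\beta\neq0$, the one-step shift of $2\rho$ is $$S_{\alpha,\beta}(w)=\frac{1}{\alpha-w-2\beta\rho(w)}=\frac{\alpha-(1-\beta)w+\beta\sqrt{w^2-4c}}{G_0(w)},$$ $$G_0(w)=\alpha^2+4c\beta^2-2\alpha(1-\beta)w+(1-2\beta)w^2.$$ A solution is a pair $(\alpha,\beta)$ with $\beta\neq\frac12$ (so $\deg G_0=2$) for which $G_0$ is proportional to $(w-a)(w-b)$; it is called positive if $\alpha\in\mathbb{R}$ and $\beta>0$, in which case $S_{\alpha,\beta}$ is the Stieltjes transform of a probability measure on $\mathbb{R}$.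
   Formalization: The counts in item 3 are stated only for distinct real roots, neither equal to ±2√c, since they fail otherwise. In the remaining real cases there is no extra positive solution if ab>0; if ab<0 there is one when exactly one root is ±2√c, and none when both are. *)

(* Defs.v *)
From HB Require Import structures.
From mathcomp Require Import all_boot all_order all_algebra.
From mathcomp Require Import complex.
From mathcomp Require Import all_classical all_reals all_analysis.

Set Implicit Arguments.
Unset Strict Implicit.
Unset Printing Implicit Defensive.

Import Order.TTheory GRing.Theory Num.Theory.
Import numFieldNormedType.Exports.

Local Open Scope classical_set_scope.
Local Open Scope ring_scope.
Local Open Scope complex_scope.

(* In the partial order of R[i], [0 < z] means that z is a positive real
   number, and [z \is Num.real] that its imaginary part vanishes. *)

Section Definitions.
Variable R : realType.
Implicit Types (c N t : R) (a b w z alpha beta : R[i]).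

Definition halfwidth c : R := 2 * Num.sqrt c.

Definition spec_interval c : set R := `[- halfwidth c, halfwidth c].

Definition branch_cut c : set R[i] := [set t%:C | t in spec_interval c].

Definition edge c z : bool :=
  (z == (halfwidth c)%:C) || (z == (- halfwidth c)%:C).

(* [sq] is the analytic branch of w |-> sqrt (w ^ 2 - 4 c) outside [branch_cut c]
   that behaves like w at infinity; these properties determine [sq] outside
   [branch_cut c], and its values on [branch_cut c] are never used. Derivability in the
   direction 1 over the field R[i] is complex differentiability. *)
Definition sqrt_branch c (sq : R[i] -> R[i]) : Prop :=
  [/\ forall w, ~ branch_cut c w -> derivable (sq : R[i]^o -> R[i]^o) w 1,
      forall w, ~ branch_cut c w -> sq w ^+ 2 = w ^+ 2 - 4 * c%:C
    & forall e : R, 0 < e ->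
        exists M : R, forall w, M%:C < `|w| -> `|sq w / w - 1| < e%:C].

Definition rho (sq : R[i] -> R[i]) w : R[i] := (- w + sq w) / 2.

Definition shiftS (sq : R[i] -> R[i]) (p : R[i] * R[i]) w : R[i] :=
  (p.1 - w - 2 * p.2 * rho sq w)^-1.

Definition G0 c alpha beta : {poly R[i]} :=
  (alpha ^+ 2 + 4 * c%:C * beta ^+ 2)%:P
  - (2 * alpha * (1 - beta)) *: 'X + (1 - 2 * beta) *: 'X^2.

(* [%=] is proportionality up to a nonzero constant. *)
Definition solution c a b (p : R[i] * R[i]) : Prop :=
  [/\ p.2 != 0, p.2 != 2^-1
    & G0 c p.1 p.2 %= ('X - a%:P) * ('X - b%:P)].

Definition positive_solution c a b (p : R[i] * R[i]) : Prop :=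
  [/\ solution c a b p, p.1 \is Num.real & 0 < p.2].

Definition Qpoly N a b t : R[i] := N%:C * (t%:C - a) * (t%:C - b).

(* [Qpoly N a b t] is real when a + b and a b are; [complex.Re] only retypes
   it in R. *)
Definition density c N a b t : R :=
  Num.sqrt (4 * c - t ^+ 2) / complex.Re (Qpoly N a b t).

Definition has_density c N a b
    (mu : probability (measurableTypeR R) R) : Prop :=
  forall A : set (measurableTypeR R), measurable A ->
    mu A = (\int[@lebesgue_measure R]_(t in
              A `&` spec_interval c) (density c N a b t)%:E)%E.

(* The integral of the complex-valued t |-> 1 / (t - w), by real and imaginary
   parts. *)
Definition stieltjes (nu : probability (measurableTypeR R) R) w : R[i] :=
  (\int[nu]_(t in setT) complex.Re (t%:C - w)^-1)
  +i* (\int[nu]_(t in setT) complex.Im (t%:C - w)^-1).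

Definition has_atom (nu : probability (measurableTypeR R) R) : Prop :=
  exists x : R, (0 < nu [set x])%E.

Definition extra_solutions c a b (p0 : R[i] * R[i]) : set (R[i] * R[i]) :=
  [set p | positive_solution c a b p /\ p <> p0].

End Definitions.

(* Main.v *)
(* Writing w = - (r + c / r) with r = rho w, |r| < sqrt c, the solutions are the
   pairs with S w = c r / ((c - u r) (c - v r)), where u is one of the two roots
   ra, c / ra attached to a (|ra| <= sqrt c), v one of rb, c / rb attached to b,
   and positivity of beta is the condition u v < c; counting the admissible choices
   gives the number of positive solutions.
   The choice u = ra, v = rb gives S_mu: integrating the resolvent against Q mu,
   a semicircle weight, for which the scaled Chebyshev polynomials of the second
   kind integrate to 0, shows that Q(w) S_mu(w) is K rho(w) plus a polynomial of
   degree at most 1, and the unknown constants are found by letting w tend to a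
   and b.
   Every other admissible choice replaces the transform by a convex combination
   of S_mu and of 1 / (a - w), 1 / (b - w). *)
Require Import Defs.
From HB Require Import structures.
From mathcomp Require Import all_boot all_order all_algebra.
From mathcomp Require Import complex.
From mathcomp Require Import all_classical all_reals all_analysis.
From mathcomp Require Import measurable_realfun ring lra zify.

Set Implicit Arguments.
Unset Strict Implicit.
Unset Printing Implicit Defensive.

Import Order.TTheory GRing.Theory Num.Theory.
Import numFieldNormedType.Exports.

Local Open Scope classical_set_scope.
Local Open Scope ring_scope.
Local Open Scope complex_scope.

(** The ends of the cut shape the argument. A root z of Q may be an end point, where [rho] is not
    specified and S_mu may blow up. So w tends to z along the points (1 + 1/(n+1)) z, and only (w -
    z) S_mu(w) -> 0 is used; at an end point this holds because mu has no atoms. When a = b, the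
    values at a and b give one and the same equation, and the missing one comes from a difference
    quotient. At an end point the roots r and c / r coincide, so exchanging them changes nothing;
    this is why degenerate positions have fewer extra solutions. Positivity of the inner choice, u v
    < c, could fail for real roots only if both sat at the same end point, which is the excluded
    case. No contour integral or residue theorem enters: boundedness selects the right solution of a
    two-term recurrence, and the partial fractions are checked as algebraic identities in rho. *)

Lemma Rintegral_density (R : realType) (mu : probability (measurableTypeR R) R)
    (D : set (measurableTypeR R)) (g : R -> R) (f : R -> R) :
  measurable D -> measurable_fun D g ->
  (forall A : set (measurableTypeR R), measurable A ->
     mu A = (\int[@lebesgue_measure R]_(t in A `&` D) (g t)%:E)%E) ->
  mu.-integrable D (EFin \o f) ->
  (\int[mu]_(t in D) f t)%R = (\int[@lebesgue_measure R]_(t in D) (f t * g t))%R.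
Proof.
move=> mD mg muE fint.
have dom : mu `<< @lebesgue_measure R.
  apply/null_content_dominatesP => A mA A0; rewrite muE//.
  apply: null_set_integral => //; first exact: measurableI.
    by apply/measurable_EFinP; apply: measurable_funS mg => //; exact: subIsetr.
  by apply: (subset_measure0 _ _ _ A0) => //; exact: measurableI.

rewrite /Rintegral; congr fine.
rewrite -(Radon_Nikodym_change_of_variables dom)//=.
have mf := measurable_int mu fint.
apply: ae_eq_integral => //.
- apply: emeasurable_funM => //; apply: (measurable_int (@lebesgue_measure R)).
  apply: (integrableS _ _ (@subsetT _ _)) => //=.
  exact: Radon_Nikodym_integrable.
- apply/measurable_EFinP; apply: measurable_funM => //.
  exact/measurable_EFinP.
(* The Radon-Nikodym derivative agrees with [g] almost everywhere on [D], since both have integral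
   mu E over every measurable subset E of [D]. *)
- under [X in ae_eq _ _ _ X]eq_fun do rewrite EFinM.
  apply: ae_eqe_mul2l => /=.
  rewrite Radon_NikodymE//=.
  case: cid => /= h [h1 h2 h3].
  apply: integral_ae_eq => //=.
  + exact: integrableS h2.
  + exact/measurable_EFinP.
  + move=> E ED mE; rewrite -h3//=.
    rewrite /charge_of_finite_measure/= muE//.
    by rewrite (setIidl ED).
Qed.

(** * Scaled Chebyshev polynomials and the semicircle weight *)

Section ScaledChebyshev.
Variables (R : realType) (c : R).
Hypothesis c_gt0 : 0 < c.

(* [chebU n] is the Chebyshev polynomial of degree n - 1 (and 0 for n = 0), scaled
   so that [chebU n] at [2 sqrt c cos x] is [sqrt c ^ (n - 1) * sin (n x) / sin x]. *)
Fixpoint chebU (n : nat) : {poly R} :=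
  if n is n'.+1 then
    if n' is n''.+1 then 'X * chebU n' - c *: chebU n'' else 1
  else 0.

Arguments chebU : simpl never.

Lemma chebU0 : chebU 0 = 0. Proof. by []. Qed.

Lemma chebU1 : chebU 1 = 1. Proof. by []. Qed.

Lemma chebUSS n : chebU n.+2 = 'X * chebU n.+1 - c *: chebU n.
Proof. by []. Qed.

Lemma horner_chebUSS n t :
  (chebU n.+2).[t] = t * (chebU n.+1).[t] - c * (chebU n).[t].
Proof. by rewrite chebUSS !hornerE. Qed.

Lemma horner_deriv_chebUSS n t : (chebU n.+2)^`().[t] =
  (chebU n.+1).[t] + t * (chebU n.+1)^`().[t] - c * (chebU n)^`().[t].
Proof.
rewrite chebUSS; move: (chebU n.+1) (chebU n) => p q.
by rewrite derivB derivM derivX derivZ mul1r !hornerE.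
Qed.

(** For t = 2 sqrt c cos x this is the derivative of sin ((n+1) x) / sin x with respect to t,
    cleared of its denominator. The recurrence has order two, hence the induction on two consecutive
    indices. *)
Lemma deriv_chebU n t :
  (4 * c - t ^+ 2) * (chebU n.+1)^`().[t] =
  n.+1%:R * (2 * c * (chebU n).[t] - t * (chebU n.+1).[t]) + t * (chebU n.+1).[t].
Proof.
suff: forall m, (4 * c - t ^+ 2) * (chebU m.+1)^`().[t] =
    m.+1%:R * (2 * c * (chebU m).[t] - t * (chebU m.+1).[t]) + t * (chebU m.+1).[t]
  /\ (4 * c - t ^+ 2) * (chebU m.+2)^`().[t] =
    m.+2%:R * (2 * c * (chebU m.+1).[t] - t * (chebU m.+2).[t])
      + t * (chebU m.+2).[t] by move=> /(_ n)[].
elim=> [|m [IH1 IH2]].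
  by rewrite chebUSS chebU1 chebU0 scaler0 subr0 mulr1 derivX -polyC1 derivC !hornerE /=;
    split; ring.
split => //; rewrite horner_deriv_chebUSS.
rewrite mulrBr mulrDr mulrCA IH2 [_ * (c * _)]mulrCA IH1.
rewrite (horner_chebUSS m.+1) [(chebU m.+2).[t]]horner_chebUSS.
rewrite -[m.+3%:R]natr1 -[m.+2%:R]natr1 -[m.+1%:R]natr1.
ring.
Qed.

(** Each step of the recurrence multiplies the form p^2 - t p q + c q^2 by c. On the cut its
    discriminant t^2 - 4 c is nonpositive, so the form controls its arguments. *)
Lemma chebU_energy n t :
  (chebU n.+1).[t] ^+ 2 - t * (chebU n.+1).[t] * (chebU n).[t]
    + c * (chebU n).[t] ^+ 2 = c ^+ n.
Proof.
elim: n => [|n IH]; first by rewrite chebU1 chebU0 !hornerE /= expr1n; ring.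
by rewrite [RHS]exprS -IH horner_chebUSS; ring.
Qed.

Lemma halfwidth_gt0 : 0 < halfwidth c.
Proof. by rewrite /halfwidth mulr_gt0// sqrtr_gt0. Qed.

Lemma sqr_halfwidth : halfwidth c ^+ 2 = 4 * c.
Proof. by rewrite /halfwidth exprMn sqr_sqrtr ?ltW//; ring. Qed.

Lemma spec_intervalP t : spec_interval c t <-> t ^+ 2 <= 4 * c.
Proof.
rewrite /spec_interval /= in_itv /= -ler_norml -sqr_halfwidth.
by rewrite -[t ^+ 2]real_normK ?num_real// ler_sqr// nnegrE ltW// halfwidth_gt0.
Qed.

(* The energy identity bounds [U_(n+2) - t/2 U_(n+1)], hence linear growth. *)
Lemma chebU_bound n t : spec_interval c t ->
  `|(chebU n.+1).[t]| <= n.+1%:R * Num.sqrt c ^+ n.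
Proof.
move=> It; elim: n => [|n IH].
  by rewrite chebU1 hornerE normr1 expr0 mulr1.
have t2 : `|t / 2| <= Num.sqrt c.
  move: It; rewrite /spec_interval /= in_itv /= -ler_norml /halfwidth => It.
  by rewrite normrM normfV (ger0_norm (ler0n R 2)) ler_pdivrMr// mulrC.
have E : ((chebU n.+2).[t] - t / 2 * (chebU n.+1).[t]) ^+ 2 <= (Num.sqrt c ^+ n.+1) ^+ 2.
  rewrite -exprM mulnC exprM sqr_sqrtr ?(ltW c_gt0)// -(chebU_energy n.+1 t).
  have /spec_intervalP := It.
  rewrite -subr_ge0 => t4; rewrite -subr_ge0.
  rewrite [X in 0 <= X](_ : _ = (4 * c - t ^+ 2) / 4 * (chebU n.+1).[t] ^+ 2);
    last by field.
  by rewrite mulr_ge0 ?sqr_ge0// divr_ge0.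
have {}E : `|(chebU n.+2).[t] - t / 2 * (chebU n.+1).[t]| <= Num.sqrt c ^+ n.+1.
  rewrite -ler_sqr ?nnegrE ?exprn_ge0 ?sqrtr_ge0//.
  by rewrite real_normK ?num_real.
rewrite -[X in `|X|](subrK (t / 2 * (chebU n.+1).[t])).
rewrite (le_trans (ler_normD _ _))// -[n.+2%:R]natr1.
rewrite [(_ + 1) * _]mulrDl mul1r addrC lerD//.
by rewrite normrM exprS mulrCA ler_pM.
Qed.

Definition semicircle (t : R) : R := Num.sqrt (4 * c - t ^+ 2).

Lemma continuous_semicircle : continuous semicircle.
Proof.
move=> t; apply: (@continuous_comp _ _ _ (fun t : R => 4 * c - t ^+ 2) Num.sqrt).
  by apply: cvgB; [exact: cvg_cst|exact: exprn_continuous].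
exact: sqrt_continuous.
Qed.

Lemma semicircle_edge t : spec_interval c t ->
  ~ (- halfwidth c < t < halfwidth c) -> semicircle t = 0.
Proof.
rewrite /spec_interval/= in_itv/= -ler_norml -ltr_norml => It /negP.
rewrite -leNgt => It'; have /eqP Et : `|t| == halfwidth c by rewrite eq_le It.
by rewrite /semicircle -sqr_halfwidth -[t ^+ 2]real_normK ?num_real// Et subrr sqrtr0.
Qed.

Lemma integral_semicircle_chebU n :
  (\int[@lebesgue_measure R]_(t in spec_interval c)
     ((chebU n.+2).[t] * semicircle t))%R = 0.
Proof.
(* In the angle x the integrand is a multiple of sin ((n+2) x) sin x, half a difference of the
   cosines of (n+1) x and (n+3) x. Integrating these gives the two terms of [V]. The antiderivative
   [F] vanishes at both ends with its semicircle factor. *)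
pose V : {poly R} := (n.+3%:R)^-1 *: chebU n.+3 - (c / n.+1%:R) *: chebU n.+1.
pose F t := semicircle t * V.[t].
have hw := halfwidth_gt0.
have h2 := sqr_halfwidth.
have cF : continuous F.
  by move=> t; apply: cvgM; [exact: continuous_semicircle|exact: continuous_horner].
have dF t : t \in `]- halfwidth c, halfwidth c[ ->
    is_derive t 1 F ((chebU n.+2).[t] * semicircle t).
  rewrite in_itv/= -ltr_norml => tI.
  have pos : 0 < 4 * c - t ^+ 2.
    rewrite -h2 -[t ^+ 2]real_normK ?num_real// subr_gt0 ltr_sqr// nnegrE//.
    exact: ltW.
  have spos : 0 < semicircle t by rewrite sqrtr_gt0.
  have s2 : semicircle t ^+ 2 = 4 * c - t ^+ 2 by rewrite sqr_sqrtr// ltW.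
  have ds : is_derive t 1 semicircle (- t / semicircle t).
    have d1 : is_derive t (1 : R) (fun t => 4 * c - t ^+ 2 : R) (- (2 * t)).
      apply: trigger_derive.
      by rewrite /GRing.scale/=; ring.
    have d2 := is_derive1_sqrt pos.
    have := @is_derive1_comp R _ _ t _ _ d2 d1.
    move=> /trigger_derive; apply.
    rewrite -/(semicircle t); field; by rewrite gt_eqF.
  have dV := is_derive_poly V t.
  have := is_deriveM ds dV => /trigger_derive; apply.
  rewrite /GRing.scale/=.
  apply: (@mulfI _ (semicircle t)); first by rewrite gt_eqF.
  have -> : semicircle t * (semicircle t * V^`().[t] + V.[t] * (- t / semicircle t))
     = (4 * c - t ^+ 2) * V^`().[t] - t * V.[t].
    by rewrite -s2; field; rewrite gt_eqF.
  have -> : semicircle t * ((chebU n.+2).[t] * semicircle t) =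
    (4 * c - t ^+ 2) * (chebU n.+2).[t] by rewrite -s2; ring.
  rewrite /V derivB !derivZ !hornerE mulrBr.
  rewrite mulrCA deriv_chebU [_ * (_ * (chebU n.+1)^`().[t])]mulrCA deriv_chebU.
  rewrite (horner_chebUSS n.+1) (horner_chebUSS n).
  have n3 : n.+3%:R != 0 :> R by [].
  have n1 : n.+1%:R != 0 :> R by [].
  move: (n.+3%:R) (n.+1%:R) n3 n1 => x3 x1 n3 n1.
  by field; rewrite n3 n1.
rewrite /Rintegral (@continuous_FTC2 _ _ F).
- rewrite /F.
  have e1 : semicircle (halfwidth c) = 0.
    by rewrite /semicircle h2 subrr sqrtr0.
  have e2 : semicircle (- halfwidth c) = 0.
    by rewrite /semicircle sqrrN h2 subrr sqrtr0.
  by rewrite e1 e2 !mul0r subee.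
- by rewrite (lt_trans _ hw)// oppr_lt0.
- apply: continuous_subspaceT => t; apply: cvgM.
    exact: continuous_horner.
  exact: continuous_semicircle.
- split.
  + by move=> t tI; have [] := dF t tI.
  + exact/cvg_at_right_filter/cF.
  + exact/cvg_at_left_filter/cF.
- by move=> t tI; rewrite derive1E; have [] := dF t tI.
Qed.

End ScaledChebyshev.

Lemma measurable_inv (R : realType) : measurable_fun [set: R] (@GRing.inv R).
Proof.
rewrite -(setUv [set 0 : R]); apply/measurable_funU => //.
- by apply: measurableC.
- split; first exact: measurable_fun_set1.
  apply: open_continuous_measurable_fun.
    exact/closed_openC/accessible_closed_set1/hausdorff_accessible/Rhausdorff.
  by move=> x; rewrite inE /= => /eqP x0; exact: inv_continuous.
Qed.

(** * Integrals of complex-valued functions over the cut *)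

Section ComplexIntegral.
Variables (R : realType) (c : R) (mu : probability (measurableTypeR R) R).
Let D : set (measurableTypeR R) := spec_interval c.
Implicit Types (f g : R -> R[i]) (k w : R[i]) (t : R).

Lemma measurable_spec_interval : measurable D.
Proof. exact: measurable_itv. Qed.
Let mD := measurable_spec_interval.

(** Unlike integrability, this condition is stable under products, and it implies integrability
    because mu is finite. *)
Definition bounded_meas f :=
  [/\ measurable_fun D (fun t => complex.Re (f t)),
      measurable_fun D (fun t => complex.Im (f t))
    & exists M : R, forall t, D t -> `|f t| <= M%:C].

Definition cint f : R[i] :=
  (\int[mu]_(t in D) complex.Re (f t))%R +i* (\int[mu]_(t in D) complex.Im (f t))%R.

Lemma ler_Re_norm (z : R[i]) (M : R) : `|z| <= M%:C -> `|complex.Re z| <= M.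
Proof. by move=> zM; rewrite -lecR (le_trans (normc_ge_Re z)). Qed.

Lemma ler_Im_norm (z : R[i]) (M : R) : `|z| <= M%:C -> `|complex.Im z| <= M.
Proof.
move=> zM; have := @ler_Re_norm (z * 'i%C) M.
by rewrite normrM {1}complexiE normCi mulr1 ReiNIm normrN; exact.
Qed.

Lemma norm_le_Re_Im (z : R[i]) : `|z| <= (`|complex.Re z| + `|complex.Im z|)%:C.
Proof.
rewrite {1}[z]complexE (le_trans (ler_normD _ _))// rmorphD /= lerD//.
  by rewrite normc_def /= expr0n addr0 sqrtr_sqr.
by rewrite normrM complexiE normCi mul1r normc_def /= expr0n addr0 sqrtr_sqr.
Qed.

Lemma norm_real (x : R) : `|x%:C| = `|x|%:C.
Proof. by rewrite normc_def /= expr0n addr0 sqrtr_sqr. Qed.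

Lemma norm_Im_le_dist w t : `|complex.Im w|%:C <= `|t%:C - w|.
Proof.
rewrite [leRHS]normc_def lecR; case: w => x y /=.
rewrite sub0r sqrrN -sqrtr_sqr ler_sqrt ?lerDr ?sqr_ge0//.
by rewrite addr_ge0 ?sqr_ge0.
Qed.

Lemma real_bounded_integrable (f : R -> R) (M : R) :
  measurable_fun D f -> (forall t, D t -> `|f t| <= M) ->
  mu.-integrable D (EFin \o f).
Proof.
move=> mf fM; apply: measurable_bounded_integrable => //.
  by apply: le_lt_trans (ltry 1); exact: probability_le1.
exists M; split; first exact: num_real.
by move=> x /ltW Mx t Dt; apply: le_trans Mx; exact: fM.
Qed.

Lemma integrable_Re f : bounded_meas f ->
  mu.-integrable D (EFin \o (fun t => complex.Re (f t))).
Proof.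
move=> [mf _ [M fM]]; apply: (real_bounded_integrable (M := M)) => // t Dt.
exact/ler_Re_norm/fM.
Qed.

Lemma integrable_Im f : bounded_meas f ->
  mu.-integrable D (EFin \o (fun t => complex.Im (f t))).
Proof.
move=> [_ mf [M fM]]; apply: (real_bounded_integrable (M := M)) => // t Dt.
exact/ler_Im_norm/fM.
Qed.

Lemma bounded_meas_real (f : R -> R) (M : R) :
  measurable_fun D f -> (forall t, D t -> `|f t| <= M) ->
  bounded_meas (fun t => (f t)%:C).
Proof.
move=> mf fM; split => //=.
by exists M => t Dt; rewrite norm_real lecR fM.
Qed.

Lemma bounded_meas_cst k : bounded_meas (fun=> k).
Proof.
split; [exact: measurable_cst..|].
exists (`|complex.Re k| + `|complex.Im k|) => t _; exact: norm_le_Re_Im.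
Qed.

Lemma bounded_measD f g : bounded_meas f -> bounded_meas g ->
  bounded_meas (fun t => f t + g t).
Proof.
move=> [f1 f2 [M fM]] [g1 g2 [N gN]]; split.
- have := measurable_funD f1 g1; apply: eq_measurable_fun => t _ /=.
  by case: (f t) (g t) => ? ? [].
- have := measurable_funD f2 g2; apply: eq_measurable_fun => t _ /=.
  by case: (f t) (g t) => ? ? [].
- exists (M + N) => t Dt; rewrite (le_trans (ler_normD _ _))// rmorphD lerD//.
    exact: fM.
  exact: gN.
Qed.

Lemma bounded_measM f g : bounded_meas f -> bounded_meas g ->
  bounded_meas (fun t => f t * g t).
Proof.
move=> [f1 f2 [M fM]] [g1 g2 [N gN]]; split.
- have := measurable_funB (measurable_funM f1 g1) (measurable_funM f2 g2).
  apply: eq_measurable_fun => t _ /=.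
  by case: (f t) (g t) => ? ? [].
- have := measurable_funD (measurable_funM f1 g2) (measurable_funM f2 g1).
  apply: eq_measurable_fun => t _ /=.
  by case: (f t) (g t) => ? ? [].
- exists (M * N) => t Dt; rewrite normrM rmorphM ler_pM//.
    exact: fM.
  exact: gN.
Qed.

Lemma bounded_meas_id : bounded_meas (fun t => t%:C).
Proof.
apply: (@bounded_meas_real id (halfwidth c)); first exact: measurable_id.
by move=> t; rewrite /D /spec_interval /= in_itv /= -ler_norml.
Qed.

Lemma measurable_Re_inv w :
  measurable_fun [set: R] (fun t : R => complex.Re (t%:C - w)^-1).
Proof.
have H : measurable_fun [set: R]
    (fun t => (t - complex.Re w) / ((t - complex.Re w) ^+ 2 + (complex.Im w) ^+ 2)).
  have m1 : measurable_fun [set: R] (fun t => t - complex.Re w).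
    by apply: measurable_funB => //; exact: measurable_id.
  apply: measurable_funM => //.
  apply: (measurableT_comp (@measurable_inv R)).
  by apply: measurable_funD => //; exact: measurable_funX.
apply: eq_measurable_fun H => t _; case: w => u v /=.
by rewrite add0r sqrrN.
Qed.

Lemma measurable_Im_inv w :
  measurable_fun [set: R] (fun t : R => complex.Im (t%:C - w)^-1).
Proof.
have H : measurable_fun [set: R]
    (fun t => complex.Im w / ((t - complex.Re w) ^+ 2 + (complex.Im w) ^+ 2)).
  have m1 : measurable_fun [set: R] (fun t => t - complex.Re w).
    by apply: measurable_funB => //; exact: measurable_id.
  apply: measurable_funM => //.
  apply: (measurableT_comp (@measurable_inv R)).
  by apply: measurable_funD => //; exact: measurable_funX.
apply: eq_measurable_fun H => t _; case: w => u v /=.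
by rewrite add0r sqrrN mulNr opprK.
Qed.

Lemma bounded_meas_inv w (d : R) : 0 < d -> (forall t, D t -> d%:C <= `|t%:C - w|) ->
  bounded_meas (fun t => (t%:C - w)^-1).
Proof.
move=> d0 dw; split.
- exact: measurable_funS (measurable_Re_inv w).
- exact: measurable_funS (measurable_Im_inv w).
- exists d^-1 => t Dt; have dC : 0 < d%:C by rewrite ltcR.
  rewrite normfV fmorphV lef_pV2 ?posrE//; first exact: dw.
  exact: lt_le_trans (dw t Dt).
Qed.

Lemma eq_cint f g : (forall t, D t -> f t = g t) -> cint f = cint g.
Proof.
by move=> fg; congr Complex; apply: eq_Rintegral => t /[!inE] /fg ->.
Qed.

Lemma cintD f g : bounded_meas f -> bounded_meas g ->
  cint (fun t => f t + g t) = cint f + cint g.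
Proof.
move=> af ag; rewrite /cint.
rewrite [RHS]/GRing.add /= -!RintegralD//;
  try (exact: integrable_Re || exact: integrable_Im).
congr Complex; apply: eq_Rintegral => t _; by case: (f t) (g t) => ? ? [].
Qed.

Lemma cintZ k f : bounded_meas f -> cint (fun t => k * f t) = k * cint f.
Proof.
move=> af; rewrite /cint; have i1 := integrable_Re af; have i2 := integrable_Im af.
have iZ (r : R) (h : R -> R) : mu.-integrable D (EFin \o h) ->
    mu.-integrable D (EFin \o (fun t => r * h t)).
  by move=> ih; exact: (integrableZl mD r ih).
case: k => k1 k2; rewrite [RHS]/GRing.mul /= -!RintegralZl//.
rewrite -RintegralB// -?RintegralD//.
- by congr Complex; apply: eq_Rintegral => t _; case: (f t).
all: exact: iZ.
Qed.

Lemma cint_real (f : R -> R) : cint (fun t => (f t)%:C) = (\int[mu]_(t in D) f t)%:C.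
Proof. by rewrite /cint /=; congr Complex; rewrite Rintegral_cst// mul0r. Qed.

(** The factor 2 comes from bounding the real and imaginary parts separately; only rates in n are
    drawn from this bound. *)
Lemma norm_cint_le f (M : R) : bounded_meas f -> 0 <= M ->
  (forall t, D t -> `|f t| <= M%:C) -> `|cint f| <= (2 * M)%:C.
Proof.
move=> af M0 fM; rewrite (le_trans (norm_le_Re_Im _))// lecR /=.
have K (h : R -> R) : mu.-integrable D (EFin \o h) -> (forall t, D t -> `|h t| <= M) ->
    `|(\int[mu]_(t in D) h t)%R| <= M.
  move=> ih hM; rewrite (le_trans (le_normr_Rintegral mD ih))//.
  have -> : M = M * 1 by rewrite mulr1.
  apply: (@le_trans _ _ (\int[mu]_(t in D) M)%R).
    apply: le_Rintegral => //; first exact: (integrable_norm ih).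
    by apply: (real_bounded_integrable (M := `|M|)) => //; exact: measurable_cst.
  rewrite Rintegral_cst// ler_wpM2l// -lee_fin fineK ?probability_le1//.
  exact: fin_num_measure.
rewrite mulr_natl mulr2n lerD// K//.
- exact: integrable_Re.
- by move=> t Dt; exact/ler_Re_norm/fM.
- exact: integrable_Im.
- by move=> t Dt; exact/ler_Im_norm/fM.
Qed.

End ComplexIntegral.

(** * The characteristic equation and its inner root *)

Section InnerBranch.
Variables (R : realType) (c : R).
Hypothesis c_gt0 : 0 < c.
Implicit Types (w z r : R[i]) (t : R).

(* The two roots [r] and [c / r] parametrize [w] as [- (r + c / r)]; off the cut
   exactly one of them, [rho], has modulus below [sqrt c]. *)
Definition char_root w r := r ^+ 2 + w * r + c%:C == 0.

(** The modulus takes values in [R[i]]; its square, taken in R, is polynomial in the coordinates and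
    suits the intermediate value theorem. *)
Definition sqnorm z : R := complex.Re z ^+ 2 + complex.Im z ^+ 2.

Lemma sqnormE z : `|z| ^+ 2 = (sqnorm z)%:C.
Proof. by rewrite -add_Re2_Im2. Qed.

Lemma sqnorm_ge0 z : 0 <= sqnorm z.
Proof. by rewrite addr_ge0 ?sqr_ge0. Qed.

Lemma norm_le_sqrt z : (`|z| <= (Num.sqrt c)%:C) = (sqnorm z <= c).
Proof.
have s0 : 0 <= (Num.sqrt c)%:C by rewrite ler0c sqrtr_ge0.
rewrite -ler_sqr ?nnegrE// sqnormE -rmorphXn /= sqr_sqrtr ?(ltW c_gt0)//.
by rewrite lecR.
Qed.

Lemma cC_neq0 : c%:C != 0 :> R[i].
Proof. by rewrite (inj_eq (@complexI R) c 0) gt_eqF. Qed.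

Lemma char_root_neq0 w r : char_root w r -> r != 0.
Proof.
move=> /eqP E; apply/eqP => r0; move: E; rewrite r0 expr0n mulr0 !add0r => /eqP.
by rewrite (negPf cC_neq0).
Qed.

Lemma char_rootE w r : char_root w r -> w = - (r + c%:C / r).
Proof.
move=> wr; have r0 := char_root_neq0 wr; apply: (mulIf r0).
rewrite mulNr mulrDl divfK// -expr2; apply/eqP.
by rewrite -addr_eq0 addrCA addrA.
Qed.

Lemma char_root_inv w r : char_root w r -> char_root w (c%:C / r).
Proof.
move=> wr; have r0 := char_root_neq0 wr; rewrite /char_root (char_rootE wr).
by apply/eqP; field.
Qed.

Lemma char_root_onto w r r' : char_root w r -> char_root w r' ->
  r' = r \/ r' = c%:C / r.
Proof.
move=> wr wr'; have r0 := char_root_neq0 wr.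
move: wr'; rewrite /char_root (char_rootE wr).
have -> : r' ^+ 2 + - (r + c%:C / r) * r' + c%:C = (r' - r) * (r' - c%:C / r) by field.
by rewrite mulf_eq0 !subr_eq0 => /orP[/eqP|/eqP]; [left|right].
Qed.

Lemma sqnormM z w : sqnorm (z * w) = sqnorm z * sqnorm w.
Proof. by case: z w => [x y] [u v]; rewrite /sqnorm /=; ring. Qed.

Lemma sqnorm_gt0 z : (0 < sqnorm z) = (z != 0).
Proof.
rewrite -(@ltcR R) -sqnormE; have [->|z0] := eqVneq z 0.
  by rewrite normr0 expr0n ltxx.
by rewrite exprn_gt0// normr_gt0.
Qed.

Lemma sqnorm_inv_root r : r != 0 -> sqnorm (c%:C / r) * sqnorm r = c ^+ 2.
Proof. by move=> r0; rewrite -sqnormM divfK// /sqnorm /= expr0n addr0. Qed.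

(** If |r|^2 = c then c / r is the conjugate of r, so w = - 2 Re r is real and at most 2 sqrt c in
    absolute value. *)
Lemma sqnorm_root_cut w r : char_root w r -> sqnorm r = c -> branch_cut c w.
Proof.
move=> wr nr; have r0 := char_root_neq0 wr.
exists (- (2 * complex.Re r)).
  apply/spec_intervalP => //; rewrite sqrrN exprMn -[_ ^+ 2]/(2 * 2).
  have -> : 2 * 2 = 4 :> R by ring.
  rewrite ler_pM2l// -nr /sqnorm.
  by rewrite lerDl sqr_ge0.
rewrite (char_rootE wr); have -> : c%:C / r = r^*%C.
  by apply: (mulIf r0); rewrite divfK// -nr -sqnormE sqr_normc mulrC.
by rewrite addcJ rmorphN rmorphM /= rmorph_nat.
Qed.

Lemma nonreal_off w : w \isn't Num.real -> ~ branch_cut c w.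
Proof.
move=> wr [t _ tw]; move: wr; rewrite -tw => /negP; apply.
by apply/complex_realP; exists t.
Qed.

(** The cut is star-shaped about 0, so moving outward from a point off the cut never meets it. *)
Lemma branch_cut_ray w (x : R) : 1 <= x -> branch_cut c (x%:C * w) -> branch_cut c w.
Proof.
move=> x1 [t It tE]; have x0 : 0 < x by exact: lt_le_trans x1.
exists (t / x).
  move/spec_intervalP : It => /(_ c_gt0) It; apply/spec_intervalP => //.
  rewrite exprMn (le_trans _ It)// ler_piMr ?sqr_ge0// exprVn invf_le1 ?exprn_gt0//.
  exact: exprn_ege1.
rewrite rmorphM /= tE fmorphV mulrAC divff ?mul1r//.
by rewrite (inj_eq (@complexI R) x 0) gt_eqF.
Qed.

Lemma continuous_along_ray (f : R[i] -> R[i]) w (x : R) :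
  {for x%:C * w, continuous (f : R[i]^o -> R[i]^o)} ->
  {for x, continuous (fun y : R => complex.Re (f (y%:C * w)) : R)} /\
  {for x, continuous (fun y : R => complex.Im (f (y%:C * w)) : R)}.
Proof.
move=> cf.
have near_ray (e : R) : 0 < e ->
    \forall y \near x, `|f (x%:C * w) - f (y%:C * w)| < e%:C.
  move=> e0; have eC : 0 < e%:C by rewrite ltcR.
  have /cvgrPdist_lt /(_ _ eC) := cf.
  rewrite nearE => /nbhs_normP[d /= d0 dB].
  have dE : d = (complex.Re d)%:C.
    by rewrite RRe_real// ger0_real// ltW.
  have rd0 : 0 < complex.Re d by rewrite -ltcR -dE.
  have nw : `|w| <= (`|complex.Re w| + `|complex.Im w|)%:C by exact: norm_le_Re_Im.
  set W := (`|complex.Re w| + `|complex.Im w|) in nw.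
  have W1 : 0 < W + 1 by rewrite ltr_wpDl// addr_ge0.
  near=> y; apply: dB => /=.
  rewrite -mulrBl normrM -rmorphB norm_real /=.
  have yx : `|x - y| < complex.Re d / (W + 1).
    by near: y; apply: cvgr_dist_lt => //; rewrite divr_gt0.
  rewrite dE; apply: (@le_lt_trans _ _ ((`|x - y| * (W + 1))%:C)).
    rewrite rmorphM ler_pM// ?ler0c// (le_trans nw)// lecR.
    by rewrite lerDl.
  by rewrite ltcR -ltr_pdivlMr.
split; apply/cvgrPdist_lt => e e0; near=> y.
- have : `|f (x%:C * w) - f (y%:C * w)| < e%:C by near: y; exact: near_ray.
  rewrite -ltcR; apply: le_lt_trans; rewrite -raddfB.
  exact: normc_ge_Re.
- have : `|f (x%:C * w) - f (y%:C * w)| < e%:C by near: y; exact: near_ray.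
  rewrite -ltcR; apply: le_lt_trans; rewrite -raddfB.
  move: (_ - _) => z; have := normc_ge_Re (z * 'i%C).
  by rewrite ReiNIm normrN normrM {1}complexiE normCi mulr1.
Unshelve. all: by end_near. Qed.

Section Branch.
Variable sq : R[i] -> R[i].
Hypothesis sq_branch : sqrt_branch c sq.

Lemma rho_root w : ~ branch_cut c w -> char_root w (rho sq w).
Proof.
move=> wc; have [_ /(_ w wc) sqE _] := sq_branch.
apply/eqP; rewrite /rho.
have -> : ((- w + sq w) / 2) ^+ 2 + w * ((- w + sq w) / 2) + c%:C =
   (sq w ^+ 2 - w ^+ 2 + 4 * c%:C) / 4 by field.
by rewrite sqE; field.
Qed.

(** For large z the asymptotics of [sq] give |r| < |z| / 2, where r = rho z. If |r| >= sqrt c, then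
    |c / r| <= sqrt c, and z = - (r + c / r) yields |z| < |z| / 2 + sqrt c, impossible once |z| > 2
    sqrt c. For w = 0 the claim is vacuous, 0 being on the cut. *)
Lemma rho_inner_near_infty w : exists x : R, 1 <= x /\
  (~ branch_cut c w -> sqnorm (rho sq (x%:C * w)) < c).
Proof.
have [_ _ /(_ 1 ltr01) [M HM]] := sq_branch.
have [w0|w0] := eqVneq w 0.
  exists 1; split => // /(_ _)[]; exists 0; rewrite ?w0//.
  by apply/spec_intervalP => //; rewrite expr0n mulr_ge0// ltW.
pose n := Num.sqrt (sqnorm w).
have nE : `|w| = n%:C by rewrite /n normc_def.
have n0 : 0 < n by rewrite -ltcR -nE normr_gt0.
(* This makes |x w| exceed both M and 2 sqrt c. *)
pose x := 1 + (`|M| + 2 * Num.sqrt c) / n.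
have s0 : 0 < Num.sqrt c by rewrite sqrtr_gt0.
have x1 : 1 <= x by rewrite lerDl divr_ge0 ?addr_ge0 ?mulr_ge0 // ltW.
exists x; split => // wc.
have xn : `|M| + 2 * Num.sqrt c < x * n.
  by rewrite /x [X in _ < X]mulrDl mul1r divfK ?gt_eqF// ltrDr.
set z := x%:C * w.
have zE : `|z| = (x * n)%:C.
  by rewrite normrM nE norm_real ger0_norm -?rmorphM// (le_trans _ x1).
have zc : ~ branch_cut c z by move/(branch_cut_ray x1).
have xn0 : 0 < x * n by rewrite mulr_gt0// (lt_le_trans _ x1).
have z0 : z != 0 by rewrite -normr_gt0 zE ltcR.
have Mz : M%:C < `|z|.
  rewrite zE ltcR (le_lt_trans (ler_norm M))// (le_lt_trans _ xn)//.
  by rewrite lerDl mulr_ge0// ltW.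
have rz := rho_root zc; set r := rho sq z in rz *.
have r0 := char_root_neq0 rz.
rewrite ltNge; apply/negP => cr.
have rlt : `|r| < (x * n / 2)%:C.
  have -> : r = z * (sq z / z - 1) / 2 by rewrite /r /rho; field.
  rewrite normrM normfV (normrM z) (ger0_norm (ler0n _ 2)) zE.
  rewrite [(x * n / 2)%:C]rmorphM fmorphV rmorph_nat /=.
  rewrite ltr_pM2r ?invr_gt0// -[X in _ < X]mulr1 ltr_pM2l; last by rewrite ltcR.
  exact: HM z Mz.
have cr' : `|c%:C / r| <= (Num.sqrt c)%:C.
  rewrite norm_le_sqrt; have := sqnorm_inv_root r0; rewrite expr2 => E.
  rewrite -(ler_pM2r c_gt0) -{}E ler_wpM2l ?sqnorm_ge0//.
have : `|z| <= `|r| + `|c%:C / r|.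
  by rewrite (char_rootE rz) normrN ler_normD.
rewrite zE => /le_lt_trans /(_ (ltr_leD rlt cr')).
rewrite -rmorphD ltcR => H.
by move: xn H (normr_ge0 M); move: (x * n) `|M| (Num.sqrt c) => p m q; lra.
Qed.

(* |rho|^2 = c only happens over the cut, so |rho|^2 - c keeps its sign along the
   ray [x w], x >= 1, which avoids the cut, and it is negative far away. *)
Lemma rho_inner w : ~ branch_cut c w -> sqnorm (rho sq w) < c.
Proof.
move=> wc; have [X [X1 /(_ wc) HX]] := rho_inner_near_infty w.
rewrite ltNge; apply/negP => Hw.
pose F x := sqnorm (rho sq (x%:C * w)).
have cF : {within `[1, X], continuous F}.
  apply: continuous_in_subspaceT => x; rewrite inE /= in_itv /= => /andP[x1 _].
  have xc : ~ branch_cut c (x%:C * w) by move/(branch_cut_ray x1).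
  have [dsq _ _] := sq_branch.
  have /differentiable_continuous/continuous_along_ray [cR cI] :
      differentiable (sq : R[i]^o -> R[i]^o) (x%:C * w : R[i]^o).
    by apply/derivable1_diffP; exact: dsq.
  have FE : F = fun y =>
      ((- (y * complex.Re w) + complex.Re (sq (y%:C * w))) / 2) ^+ 2 +
      ((- (y * complex.Im w) + complex.Im (sq (y%:C * w))) / 2) ^+ 2.
    apply/funext => y; rewrite /F /sqnorm /rho.
    have -> : 2^-1 = (2^-1)%:C :> R[i] by rewrite fmorphV rmorph_nat.
    case: (sq _) => u v; case: w {wc X X1 HX Hw F xc cR cI} => u' v' /=.
    by rewrite !(mul0r, mulr0, subr0, addr0, add0r).
  have cl (a : R) (g : R -> R) : {for x, continuous g} ->
      {for x, continuous (fun y : R => ((- (y * a) + g y) / 2) ^+ 2 : R)}.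
    move=> cg; apply: (@continuous_comp _ _ _ (fun y : R => (- (y * a) + g y) / 2 : R)
      (fun y : R => y ^+ 2 : R)).
      apply: cvgM; last exact: cvg_cst.
      apply: cvgD cg; apply: cvgN; apply: cvgM; [exact: cvg_id|exact: cvg_cst].
    exact: exprn_continuous.
  rewrite FE; apply: cvgD; exact: cl.
have [x /[!in_itv] /= /andP[x1 _] Fx] : exists2 x, x \in `[1, X] & F x = c.
  apply: IVT => //.
  by rewrite /F mul1r ge_min le_max Hw (ltW HX) /= orbT.
apply: (wc); apply: (branch_cut_ray x1).
apply: (sqnorm_root_cut _ Fx); apply: rho_root.
by move/(branch_cut_ray x1).
Qed.

End Branch.
End InnerBranch.

(** Bernoulli's inequality alone makes x^m grow only linearly, so it is applied to x^(2m) = (x^m)^2,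
    whose quadratic growth beats the linear bound. *)
Lemma linear_bound_geometric (R : realType) (x e C : R) :
  1 < x -> 0 <= e -> (forall n : nat, x ^+ n * e <= C * n.+1%:R) -> e = 0.
Proof.
move=> x1 e0 H.
have x0 : 0 <= x by rewrite ltW// (lt_trans ltr01).
have d0 : 0 < x - 1 by rewrite subr_gt0.
have bern m : m%:R * (x - 1) <= x ^+ m.
  elim: m => [|m IH]; first by rewrite mul0r expr0.
  have xm : 1 <= x ^+ m by rewrite exprn_ege1// ltW.
  by rewrite exprS -natr1; nra.
apply/eqP; rewrite eq_le e0 andbT; apply/negP => /negP; rewrite -ltNge => e1.
have K m : m.+1%:R * ((x - 1) ^+ 2 * e) <= 3 * C.
  have m0 : 0 < m.+1%:R :> R by rewrite ltr0n.
  have := H (m.+1 * 2)%N; rewrite exprM => Hm.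
  have C0 : 0 <= C.
    have := H 0%N; rewrite expr0 mul1r mulr1; exact: le_trans.
  have B : (m.+1%:R * (x - 1)) ^+ 2 <= (x ^+ m.+1) ^+ 2.
    by rewrite ler_sqr ?nnegrE ?exprn_ge0// mulr_ge0// ltW.
  have B' := le_trans (ler_wpM2r e0 B) Hm.
  rewrite -(ler_pM2l m0).
  apply: le_trans (_ : C * (m.+1 * 2).+1%:R <= _).
    by apply: le_trans B'; rewrite le_eqVlt; apply/orP; left; apply/eqP; ring.
  have N : (m.+1 * 2).+1%:R <= 3 * m.+1%:R :> R by rewrite -natrM ler_nat; lia.
  rewrite (le_trans (ler_wpM2l C0 N))// le_eqVlt; apply/orP; left; apply/eqP; ring.
have E0 : 0 < (x - 1) ^+ 2 * e by rewrite mulr_gt0// exprn_gt0.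
have := K (Num.truncn (3 * C / ((x - 1) ^+ 2 * e))).
rewrite -ler_pdivlMr// leNgt => /negP; apply.
exact: truncnS_gt.
Qed.

(** * The resolvent integrated against Q mu *)

Section Stieltjes.
Variables (R : realType) (c : R) (a b : R[i]) (N : R).
Variable mu : probability (measurableTypeR R) R.
Hypotheses (c_gt0 : 0 < c).
Hypotheses (ab_sum_real : a + b \is Num.real) (ab_prod_real : a * b \is Num.real).
Hypothesis N_neq0 : N != 0.
Hypothesis Q_gt0 : forall t : R, - halfwidth c < t < halfwidth c -> 0 < Qpoly N a b t.
Hypothesis mu_density : has_density c N a b mu.
Implicit Types (w r : R[i]) (t : R).

Let D : set (measurableTypeR R) := spec_interval c.
Let mD : measurable D := @measurable_spec_interval R c.
Let Qr t := complex.Re (Qpoly N a b t).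
Let cint := cint c mu.

Lemma Qpoly_real t : Qpoly N a b t = (Qr t)%:C.
Proof.
rewrite /Qr RRe_real// /Qpoly.
have -> : N%:C * (t%:C - a) * (t%:C - b) = N%:C * (t%:C * t%:C - (a + b) * t%:C + a * b).
  by ring.
have rC (x : R) : x%:C \is Num.real by apply/complex_realP; exists x.
by rewrite realM ?rC// realD// realB// realM ?rC.
Qed.

Lemma bounded_meas_Q : bounded_meas c (Qpoly N a b).
Proof.
have H z : bounded_meas c (fun t => t%:C - z).
  by apply: bounded_measD; [exact: bounded_meas_id|exact: bounded_meas_cst].
apply: bounded_measM; last exact: H.
by apply: bounded_measM; [exact: bounded_meas_cst|exact: H].
Qed.

Lemma measurable_horner (p : {poly R}) : measurable_fun D (horner p).
Proof.
apply: measurable_funTS; apply: continuous_measurable_fun.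
exact: continuous_horner.
Qed.

Lemma bounded_meas_chebU n : bounded_meas c (fun t => ((chebU c n).[t])%:C).
Proof.
case: n => [|n].
  have := bounded_meas_cst c (0 : R[i]); congr bounded_meas; apply/funext => t.
  by rewrite chebU0 horner0.
apply: (@bounded_meas_real _ _ _ (n.+1%:R * Num.sqrt c ^+ n)).
  exact: measurable_horner.
by move=> t Dt; exact: chebU_bound.
Qed.

Lemma measurable_density : measurable_fun D (density c N a b).
Proof.
apply: measurable_funM.
  apply: measurable_funTS; apply: continuous_measurable_fun.
  exact: continuous_semicircle.
have [mQ _ _] := bounded_meas_Q.
exact: (measurableT_comp (@measurable_inv R)).
Qed.

(** Q may vanish at an end of the cut, where the quotient is then 0 by convention; the semicircle
    weight is 0 there as well. *)
Lemma mul_Q_density t : D t -> Qr t * density c N a b t = semicircle c t.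
Proof.
move=> Dt; rewrite /density -/(Qr t) -/(semicircle c t).
have [/Q_gt0|/negP tI] := boolP (- halfwidth c < t < halfwidth c).
  by rewrite Qpoly_real ltcR => Q0; rewrite mulrC divfK// gt_eqF.
by rewrite (semicircle_edge c_gt0 Dt)// mul0r mulr0.
Qed.

Lemma integrable_real (f : R -> R) : bounded_meas c (fun t => (f t)%:C) ->
  mu.-integrable D (EFin \o f).
Proof. by move/(@integrable_Re _ _ mu). Qed.

Lemma integral_chebU_Q n : (\int[mu]_(t in D) ((chebU c n.+2).[t] * Qr t))%R = 0.
Proof.
rewrite (Rintegral_density mD measurable_density mu_density); last first.
  apply: (@integrable_real (fun t => (chebU c n.+2).[t] * Qr t)).
  have := bounded_measM (bounded_meas_chebU n.+2) bounded_meas_Q.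
  by congr bounded_meas; apply/funext => t; rewrite rmorphM Qpoly_real.
rewrite -[RHS](integral_semicircle_chebU c_gt0 n).
by apply: eq_Rintegral => t; rewrite inE => Dt; rewrite -mulrA mul_Q_density.
Qed.

Lemma mu_spec_interval : mu D = 1%E.
Proof.
rewrite -(probability_setT mu) !mu_density//.
by congr integral; rewrite setTI setIid.
Qed.

Lemma mu_spec_intervalC : mu (~` D) = 0%E.
Proof. by rewrite probability_setC// mu_spec_interval subee. Qed.

Lemma stieltjesE w : stieltjes mu w = cint (fun t => (t%:C - w)^-1).
Proof.
have H (f : R -> R) : measurable_fun [set: R] f ->
    (\int[mu]_(t in setT) f t)%R = (\int[mu]_(t in D) f t)%R.
  move=> mf; rewrite /Rintegral; congr fine.
  rewrite -(setUv D) integral_setU//; last 3 first.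
  - exact: measurableC.
  - by apply/measurable_EFinP; apply: measurable_funTS.
  - by apply/disj_setPS; rewrite setICr.
  rewrite [X in (_ + X)%E]null_set_integral ?adde0//.
  - exact: measurableC.
  - by apply/measurable_EFinP; apply: measurable_funTS.
  - exact: mu_spec_intervalC.
by congr Complex; apply: H; [exact: measurable_Re_inv|exact: measurable_Im_inv].
Qed.

Lemma cut_distance w : ~ branch_cut c w ->
  exists2 d : R, 0 < d & forall t, D t -> d%:C <= `|t%:C - w|.
Proof.
move=> wc; have [w0|w0] := eqVneq (complex.Im w) 0.
  have wE : w = (complex.Re w)%:C by case: w w0 {wc} => x y /= ->.
  have : ~ D (complex.Re w) by move=> h; apply: wc; exists (complex.Re w).
  rewrite /D /spec_interval /= in_itv /= -ler_norml => /negP; rewrite -ltNge => h.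
  exists (`|complex.Re w| - halfwidth c); first by rewrite subr_gt0.
  move=> t; rewrite /D /spec_interval /= in_itv /= -ler_norml => tI.
  rewrite wE -rmorphB norm_real lecR /= distrC.
  by apply: le_trans (lerB_dist _ _); rewrite lerB.
exists `|complex.Im w|; first by rewrite normr_gt0.
by move=> t _; exact: norm_Im_le_dist.
Qed.

Let K0 : R := (\int[mu]_(t in D) Qr t)%R.

Section OneEvaluation.
(* The moments [J n] of [U_n Q / (t - w)] satisfy the recurrence of the [U_n], up
   to the source term [K0] at n = 1.  Its characteristic roots are [- r] and
   [- c / r]; the latter grows faster than [|U_n|] allows, so its component
   vanishes, which determines [J 1]. *)
Variables (w r : R[i]).
Hypotheses (w_off : ~ branch_cut c w) (wr : char_root c w r) (r_inner : sqnorm r < c).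

Let J n := cint (fun t => Qpoly N a b t * ((chebU c n).[t])%:C * (t%:C - w)^-1).

Let bm_inv : bounded_meas c (fun t => (t%:C - w)^-1).
Proof. by have [d d0 dw] := cut_distance w_off; exact: (bounded_meas_inv d0). Qed.

Let offP t : D t -> t%:C - w != 0.
Proof. by move=> Dt; rewrite subr_eq0; apply/eqP => tw; apply: w_off; exists t. Qed.

Let bm_J n : bounded_meas c (fun t => Qpoly N a b t * ((chebU c n).[t])%:C * (t%:C - w)^-1).
Proof.
apply: bounded_measM bm_inv; apply: bounded_measM; first exact: bounded_meas_Q.
exact: bounded_meas_chebU.
Qed.

Let bm_QU n : bounded_meas c (fun t => Qpoly N a b t * ((chebU c n).[t])%:C).
Proof. by apply: bounded_measM; [exact: bounded_meas_Q|exact: bounded_meas_chebU]. Qed.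

(** Writing t = (t - w) + w in the recurrence of [chebU] cancels the resolvent in one term, which
    becomes the source. *)
Let J_rec n : J n.+2 =
  w * J n.+1 + - c%:C * J n + cint (fun t => Qpoly N a b t * ((chebU c n.+1).[t])%:C).
Proof.
rewrite /J /cint -!cintZ//.
have bmZ k m : bounded_meas c (fun t => k *
    (Qpoly N a b t * ((chebU c m).[t])%:C * (t%:C - w)^-1)).
  by apply: bounded_measM; [exact: bounded_meas_cst|exact: bm_J].
rewrite -!cintD//; last exact: bounded_measD.
apply: eq_cint => t /offP tw.
by rewrite horner_chebUSS rmorphB !rmorphM /=; field.
Qed.

Let int_QU n : cint (fun t => Qpoly N a b t * ((chebU c n.+1).[t])%:C) =
  if n is 0 then K0%:C else 0.
Proof.
have E m : (fun t => Qpoly N a b t * ((chebU c m).[t])%:C) =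
    (fun t => ((chebU c m).[t] * Qr t)%:C).
  by apply/funext => t; rewrite Qpoly_real mulrC -rmorphM.
rewrite /cint E cint_real; case: n => [|n]; last by rewrite integral_chebU_Q.
by congr (_%:C); apply: eq_Rintegral => t _; rewrite chebU1 hornerC mul1r.
Qed.

Let J0 : J 0 = 0.
Proof.
rewrite /J /cint (@eq_cint _ _ _ _ (fun=> (0 : R)%:C)).
  by rewrite cint_real Rintegral_cst// mul0r.
by move=> t _; rewrite chebU0 horner0 mulr0 mul0r.
Qed.

Lemma int_Q_resolvent :
  cint (fun t => Qpoly N a b t * (t%:C - w)^-1) = K0%:C / c%:C * r.
Proof.
have r0 := char_root_neq0 c_gt0 wr.
have c0 := cC_neq0 c_gt0.
have wE := char_rootE c_gt0 wr.
have <- : J 1 = cint (fun t => Qpoly N a b t * (t%:C - w)^-1).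
  by apply: eq_cint => t _; rewrite chebU1 hornerC mulr1.
(* [E] filters out the component of ratio - r, so it is geometric of ratio [q]. Its start [E 0]
   contains both J 1 and the source K0, and its vanishing is the claim. *)
pose q := - (c%:C / r).
pose E n := J n.+2 + r * J n.+1.
have E_geo n : E n = q ^+ n * E 0.
  elim: n => [|n IH]; first by rewrite mul1r.
  rewrite exprS -mulrA -IH /E (J_rec n.+1) int_QU addr0 /q wE.
  by field.
have E00 : E 0 = q * J 1 + K0%:C.
  by rewrite /E J_rec J0 int_QU mulr0 addr0 /q wE; field.
suff E0 : E 0 = 0.
  move: E0; rewrite E00 /q => /eqP; rewrite addrC mulNr subr_eq0 => /eqP ->.
  by field; rewrite r0 c0.
have [d d0 dw] := cut_distance w_off.
have [_ _ [M HM]] := bounded_meas_Q.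
pose s := Num.sqrt c; have s0 : 0 < s by rewrite sqrtr_gt0.
have M0 : 0 <= M.
  have D0 : D 0 by apply/spec_intervalP; rewrite // expr0n mulr_ge0// ltW.
  by rewrite -ler0c (le_trans _ (HM 0 D0)).
have J_le n : `|J n.+1| <= (2 * (M * (n.+1%:R * s ^+ n) / d))%:C.
  apply: norm_cint_le => //.
    by rewrite !mulr_ge0// ?invr_ge0 ?exprn_ge0// ltW.
  move=> t Dt; rewrite normrM normfV (normrM (Qpoly N a b t)) rmorphM rmorphM fmorphV.
  apply: ler_pM => //; rewrite ?mulr_ge0// ?invr_ge0//.
    by apply: ler_pM => //; [exact: HM|rewrite norm_real lecR chebU_bound].
  have dC0 : 0 < d%:C by rewrite ltcR.
  by rewrite lef_pV2 ?posrE ?(lt_le_trans dC0) ?dw.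
have rs : `|r| <= s%:C by rewrite norm_le_sqrt// ltW.
have nr0 : 0 < Num.sqrt (sqnorm r) by rewrite sqrtr_gt0 sqnorm_gt0.
have nrE : `|r| = (Num.sqrt (sqnorm r))%:C by rewrite normc_def.
have nrs : Num.sqrt (sqnorm r) < s by rewrite ltr_sqrt.
have E_le n : `|E n| <= (6 * (M * s / d) * (n.+1%:R * s ^+ n))%:C.
  rewrite (le_trans (ler_normD _ _))// normrM.
  apply: (@le_trans _ _ ((2 * (M * (n.+2%:R * s ^+ n.+1) / d))%:C
      + s%:C * (2 * (M * (n.+1%:R * s ^+ n) / d))%:C)).
    rewrite lerD// ler_pM//.
  rewrite -rmorphM -rmorphD lecR.
  have n2 : n.+2%:R <= 2 * n.+1%:R :> R by 
    rewrite -natrM ler_nat mul2n -addnn addSn addnS !ltnS leq_addr.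
  have P : 0 <= M * s / d * s ^+ n by rewrite !mulr_ge0 ?invr_ge0 ?exprn_ge0// ltW.
  rewrite exprS.
  have -> : 2 * (M * (n.+2%:R * (s * s ^+ n)) / d)
      + s * (2 * (M * (n.+1%:R * s ^+ n) / d)) =
    (M * s / d * s ^+ n) * (2 * (n.+2%:R + n.+1%:R)) by ring.
  have -> : 6 * (M * s / d) * (n.+1%:R * s ^+ n) =
    (M * s / d * s ^+ n) * (6 * n.+1%:R) by ring.
  rewrite ler_wpM2l//; lra.
have qE : `|q| = (s * (s / Num.sqrt (sqnorm r)))%:C.
  rewrite /q normrN normrM normfV nrE norm_real (gtr0_norm c_gt0) mulrA.
  by rewrite rmorphM fmorphV -expr2 sqr_sqrtr// ltW.
apply/eqP; rewrite -normr_eq0 normc_def.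
set e := Num.sqrt _; suff -> : e = 0 by [].
(* After division by s^n, |E 0| (s / |r|)^n is bounded linearly in n, while s / |r| > 1 because r is
   inner. *)
apply: (@linear_bound_geometric _ (s / Num.sqrt (sqnorm r)) _ (6 * (M * s / d))).
- by rewrite ltr_pdivlMr// mul1r.
- exact: sqrtr_ge0.
- move=> n; have := E_le n; rewrite E_geo normrM normrX qE (normc_def (E 0)) -/e.
  rewrite -rmorphXn -rmorphM lecR /= exprMn.
  have sn : 0 < s ^+ n by rewrite exprn_gt0.
  move=> H; rewrite -(ler_pM2l sn) [leLHS]mulrA (le_trans H)//.
  by rewrite [leRHS]mulrC [leLHS]mulrA.
Qed.

End OneEvaluation.
End Stieltjes.

(** * Limits of complex sequences along outward rays *)

Definition clim (K : numFieldType) (u : nat -> K) (l : K) : Prop := u @ \oo --> l.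

Section Clim.
Variable K : numFieldType.
Implicit Types (u v : nat -> K) (l m : K).

Lemma climP u l : clim u l <->
  forall e : K, 0 < e -> exists n0, forall n, (n0 <= n)%N -> `|u n - l| < e.
Proof.
split.
  move=> /cvgrPdist_lt H e /H [n0 _ Hn]; exists n0 => n n0n.
  by rewrite distrC; exact: Hn.
move=> H; apply/cvgrPdist_lt => e /H [n0 Hn]; exists n0 => // n n0n.
by rewrite /= distrC; exact: Hn.
Qed.

Lemma clim_cst l : clim (fun=> l) l. Proof. exact: cvg_cst. Qed.

Lemma climD u v l m : clim u l -> clim v m -> clim (fun n => u n + v n) (l + m).
Proof. exact: cvgD. Qed.

Lemma climB u v l m : clim u l -> clim v m -> clim (fun n => u n - v n) (l - m).
Proof. exact: cvgB. Qed.

Lemma climM u v l m : clim u l -> clim v m -> clim (fun n => u n * v n) (l * m).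
Proof. exact: cvgM. Qed.

Lemma clim_unique u v l m : clim u l -> clim v m -> u =1 v -> l = m.
Proof.
move=> ul vm /funext uv; move: ul; rewrite uv => ul.
exact: (cvg_unique _ ul vm).
Qed.

End Clim.

Arguments clim_cst {K} l.
Arguments climD {K u v l m} _ _.
Arguments climB {K u v l m} _ _.
Arguments climM {K u v l m} _ _.

Section ComplexLimit.
Variable R : realType.
Implicit Types (u : nat -> R[i]) (l : R[i]).

Lemma clim_squeeze u l (x : nat -> R) :
  (forall n, `|u n - l| <= (x n)%:C) -> x @ \oo --> (0 : R) -> clim u l.
Proof.
move=> ux x0; apply/climP => e e0.
have eE : e = (complex.Re e)%:C by rewrite RRe_real// ger0_real// ltW.
have re0 : 0 < complex.Re e by rewrite -ltcR -eE.
have [n0 _ Hn] := cvgr0_norm_lt _ x0 _ re0; exists n0 => n n0n.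
rewrite (le_lt_trans (ux n))// eE ltcR (le_lt_trans (ler_norm _))//.
exact: Hn.
Qed.

Lemma clim_squeeze_inv u l (C : R) :
  (forall n, `|u n - l| <= (C * n.+1%:R^-1)%:C) -> clim u l.
Proof.
move=> uC; apply: (clim_squeeze uC).
rewrite -[X in _ --> X](mulr0 C); apply: cvgM; first exact: cvg_cst.
exact: cvg_harmonic.
Qed.

(** A radial approach from outside stays off the cut even when w is one of its end points. *)
Definition ray (w : R[i]) (n : nat) : R[i] := (1 + n.+1%:R^-1)%:C * w.

Lemma clim_ray w : clim (ray w) w.
Proof.
apply: (@clim_squeeze_inv _ _ (Num.sqrt (sqnorm w))) => n.
rewrite /ray rmorphD rmorph1 mulrDl mul1r addrAC subrr add0r.
rewrite [leRHS](_ : _ = (Num.sqrt (sqnorm w))%:C * (n.+1%:R^-1)%:C); last first.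
  exact: rmorphM.
have n0 : 0 <= n.+1%:R^-1 :> R by rewrite invr_ge0.
by rewrite normrM norm_real (ger0_norm n0) mulrC (normc_def w).
Qed.

End ComplexLimit.

Arguments clim_ray {R} w.

(** * The Stieltjes transform off the cut *)

Section StieltjesIdentity.
Variables (R : realType) (c : R) (a b : R[i]) (N : R).
Variable mu : probability (measurableTypeR R) R.
Variable sq : R[i] -> R[i].
Hypotheses (c_gt0 : 0 < c).
Hypotheses (ab_sum_real : a + b \is Num.real) (ab_prod_real : a * b \is Num.real).
Hypothesis N_neq0 : N != 0.
Hypothesis Q_gt0 : forall t : R, - halfwidth c < t < halfwidth c -> 0 < Qpoly N a b t.
Hypothesis mu_density : has_density c N a b mu.
Hypothesis sq_branch : sqrt_branch c sq.
Implicit Types (w z o r : R[i]) (t : R).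

Let D : set (measurableTypeR R) := spec_interval c.
Let S := stieltjes mu.
Local Notation r_ := (rho sq).
Let mD : measurable D := @measurable_spec_interval R c.

(** Dividing Q(t) by t - w leaves the remainder Q(w) and the quotient N (t + w - a - b). Integration
    turns the quotient into the affine term, m1 being the mean of mu; K is the total mass of Q mu
    divided by c. *)
Lemma stieltjes_identity : exists K m1 : R, forall w, ~ branch_cut c w ->
  N%:C * ((w - a) * (w - b)) * S w + N%:C * (m1%:C + w - a - b) = K%:C * r_ w.
Proof.
exists ((\int[mu]_(t in D) complex.Re (Qpoly N a b t))%R / c),
  (\int[mu]_(t in D) t)%R => w wc.
have [d d0 dw] := cut_distance wc.
have bi : bounded_meas c (fun t => (t%:C - w)^-1) := bounded_meas_inv d0 dw.
rewrite rmorphM fmorphV -(int_Q_resolvent c_gt0 ab_sum_real ab_prod_real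
  Q_gt0 mu_density wc (rho_root sq_branch wc) (rho_inner c_gt0 sq_branch wc)).
have -> : cint c mu (fun t => Qpoly N a b t * (t%:C - w)^-1) =
    cint c mu (fun t => N%:C * ((w - a) * (w - b)) * (t%:C - w)^-1 +
      (N%:C * t%:C + N%:C * (w - a - b) * 1)).
  apply: eq_cint => t Dt; rewrite /Qpoly.
  have tw : t%:C - w != 0 by rewrite subr_eq0; apply/eqP => tw; apply: wc; exists t.
  by field.
have bc k : bounded_meas c (fun=> k) := bounded_meas_cst c k.
have bid : bounded_meas c (fun t => t%:C) := bounded_meas_id c.
have bD k : bounded_meas c (fun t => k * t%:C) by exact: bounded_measM.
have bI k : bounded_meas c (fun t => k * (t%:C - w)^-1) by exact: bounded_measM.
have b1 k : bounded_meas c (fun t => k * 1) by exact: bc.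
rewrite cintD//; last exact: bounded_measD.
rewrite cintD// !cintZ//.
rewrite /S (stieltjesE mu_density) (@cint_real _ _ _ (@id R)).
rewrite (@cint_real _ _ _ (cst (1 : R))).
rewrite Rintegral_cst// (_ : fine _ = 1); last first.
  exact: (congr1 fine (mu_spec_interval mu_density)).
rewrite mulr1.
by ring.
Qed.

Lemma ray_off w n : ~ branch_cut c w -> ~ branch_cut c (ray w n).
Proof.
by move=> wc /(branch_cut_ray c_gt0); rewrite lerDl invr_ge0 => /(_ (ler0n _ _)).
Qed.

Lemma ray_sub w n : ray w n - w = (n.+1%:R^-1)%:C * w.
Proof. by rewrite /ray rmorphD rmorph1 mulrDl mul1r addrAC subrr add0r. Qed.

(** By the resolvent identity the difference is [ray w n - w] times a bounded integral. The distance
    from w to the cut serves the whole ray, since t - x w = x (t / x - w) and t / x stays in the cut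
    for x >= 1. *)
Lemma stieltjes_ray w : ~ branch_cut c w -> clim (fun n => S (ray w n)) (S w).
Proof.
move=> wc; have [d d0 dw] := cut_distance wc.
have dwn n t : D t -> d%:C <= `|t%:C - ray w n|.
  move=> Dt; set x := 1 + n.+1%:R^-1 : R.
  have x1 : 1 <= x by rewrite lerDl.
  have x0 : 0 < x := lt_le_trans ltr01 x1.
  have xC : x%:C != 0 by rewrite (inj_eq (@complexI R) x 0) gt_eqF.
  have Dtx : D (t / x).
    move/(spec_intervalP c_gt0) : Dt => Dt; apply/(spec_intervalP c_gt0).
    rewrite exprMn (le_trans _ Dt)// ler_piMr ?sqr_ge0// exprVn invf_le1 ?exprn_gt0//.
    exact: exprn_ege1.
  have -> : t%:C - ray w n = x%:C * ((t / x)%:C - w).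
    by rewrite /ray -/x rmorphM fmorphV; field.
  rewrite normrM norm_real (gtr0_norm x0) -[leLHS]mul1r ler_pM ?ler01//.
  - by rewrite ler0c ltW.
  - by have : 1%:C <= x%:C by rewrite lecR.
  - exact: dw.
apply: (@clim_squeeze_inv _ _ _ (Num.sqrt (sqnorm w) * (2 * (d^-1 * d^-1)))) => n.
have bi : bounded_meas c (fun t => (t%:C - w)^-1) := bounded_meas_inv d0 dw.
have bn : bounded_meas c (fun t => (t%:C - ray w n)^-1) := bounded_meas_inv d0 (dwn n).
have bp := bounded_measM bn bi.
have -> : S (ray w n) - S w = (ray w n - w) *
    cint c mu (fun t => (t%:C - ray w n)^-1 * (t%:C - w)^-1).
  rewrite /S !(stieltjesE mu_density) -[X in _ + X]mulN1r.
  rewrite -(cintZ mu (-1) bi) -(cintZ mu _ bp) -cintD//; last first.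
    by apply: bounded_measM bi; exact: bounded_meas_cst.
  apply: eq_cint => t Dt.
  have tw : t%:C - w != 0 by rewrite subr_eq0; apply/eqP => tw; apply: wc; exists t.
  have twn : t%:C - ray w n != 0.
    by rewrite subr_eq0; apply/eqP => twn; apply: (@ray_off w n wc); exists t.
  by field; rewrite tw twn.
have n0 : 0 <= n.+1%:R^-1 :> R by rewrite invr_ge0.
rewrite normrM ray_sub normrM norm_real (ger0_norm n0).
rewrite (normc_def w) -/(sqnorm w).
rewrite [leRHS](_ : _ = (n.+1%:R^-1)%:C * (Num.sqrt (sqnorm w))%:C *
    (2 * (d^-1 * d^-1))%:C); last first.
  by rewrite -!rmorphM; congr (_%:C); ring.
apply: ler_pM => //.
  by rewrite mulr_ge0 ?ler0c ?invr_ge0 ?sqrtr_ge0.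
apply: norm_cint_le => //.
  by rewrite mulr_ge0// invr_ge0 ltW.
move=> t Dt; rewrite normrM !normfV rmorphM.
have dC0 : 0 < d%:C by rewrite ltcR.
by apply: ler_pM; rewrite ?invr_ge0// fmorphV lef_pV2 ?posrE ?(lt_le_trans dC0) ?dw ?dwn.
Qed.

End StieltjesIdentity.

(** * Limits of rho at points off the cut and at its ends *)

Section InnerRootLimit.
Variables (R : realType) (c : R) (sq : R[i] -> R[i]).
Hypothesis c_gt0 : 0 < c.
Hypothesis sq_branch : sqrt_branch c sq.
Implicit Types (z w r : R[i]).

(* At an end point of the cut, where [rho] is not defined, the double root takes
   its place. *)
Definition inner_root z r : Prop :=
  char_root c z r /\
  ((~ branch_cut c z /\ sqnorm r < c) \/ (edge c z /\ r = - z / 2)).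

Lemma edgeP z : edge c z -> z ^+ 2 = (4 * c)%:C /\ z \is Num.real.
Proof.
have rC (x : R) : x%:C \is Num.real by apply/complex_realP; exists x.
rewrite -(sqr_halfwidth c_gt0) => /orP[]/eqP ->; rewrite rC -rmorphXn//.
by rewrite sqrrN.
Qed.

Lemma edge_inner_root z : edge c z -> inner_root z (- z / 2).
Proof.
move=> ze; split; last by right.
have [z2 _] := edgeP ze; apply/eqP.
have -> : (- z / 2) ^+ 2 + z * (- z / 2) + c%:C = (4 * c%:C - z ^+ 2) / 4 by field.
by rewrite z2 rmorphM rmorph_nat subrr mul0r.
Qed.

Lemma off_inner_root z : ~ branch_cut c z -> inner_root z (rho sq z).
Proof.
move=> zc; split; first exact: rho_root.
by left; split => //; exact: rho_inner.
Qed.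

Lemma edge_ray_off z n : edge c z -> ~ branch_cut c (ray z n).
Proof.
move=> /edgeP[z2 /complex_realP[k zk]] [t It tz].
have /(spec_intervalP c_gt0) := It; apply/negP; rewrite -ltNge.
have /complexI k2 : (k ^+ 2)%:C = (4 * c)%:C by rewrite -z2 zk rmorphXn.
have x1 : 1 < 1 + n.+1%:R^-1 :> R by rewrite ltrDl invr_gt0.
have /complexI -> : t%:C = ((1 + n.+1%:R^-1) * k)%:C by rewrite tz /ray zk rmorphM.
by rewrite exprMn k2 ltr_pMl ?mulr_gt0// expr_gt1// ltW// (lt_trans ltr01).
Qed.

Lemma inner_root_ray_off z r n : inner_root z r -> ~ branch_cut c (ray z n).
Proof. by case=> _ [[zc _]|[ze _]]; [exact: ray_off|exact: edge_ray_off]. Qed.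

(** The left side is the characteristic polynomial of z at rho (ray z n). That of [ray z n] vanishes
    there, and the two differ only in their linear term. *)
Lemma rho_ray_eq z r n : inner_root z r ->
  (rho sq (ray z n) - r) * (rho sq (ray z n) - c%:C / r) =
  - ((n.+1%:R^-1)%:C * z * rho sq (ray z n)).
Proof.
move=> zr; have /eqP := rho_root sq_branch (inner_root_ray_off (n := n) zr).
case: zr => rr _; rewrite -ray_sub.
have r0 := char_root_neq0 c_gt0 rr.
have := char_rootE c_gt0 rr.
move: (rho sq (ray z n)) (ray z n) => q w' zE E.
rewrite -[RHS]addr0 -{}E [in RHS]zE.
by field.
Qed.

(** By [rho_ray_eq] the product of the distances to r and c / r tends to 0. Off the cut the distance
    to c / r stays above c / |r| - sqrt c > 0; at an end point both roots are r, and the rate drops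
    to a square root. *)
Lemma clim_rho_ray z r : inner_root z r -> clim (fun n => rho sq (ray z n)) r.
Proof.
move=> zr; pose q n := rho sq (ray z n); pose s := Num.sqrt c.
have s0 : 0 < s by rewrite sqrtr_gt0.
pose Z := Num.sqrt (sqnorm z).
have rho_s n : `|q n| <= s%:C.
  rewrite norm_le_sqrt// ltW//.
  exact: (rho_inner c_gt0 sq_branch (inner_root_ray_off (n := n) zr)).
have n0 n : 0 <= n.+1%:R^-1 :> R by rewrite invr_ge0.
have E n : `|q n - r| * `|q n - c%:C / r| <= (Z * s * n.+1%:R^-1)%:C.
  rewrite -normrM (rho_ray_eq n zr) normrN normrM normrM norm_real (ger0_norm (n0 n)).
  rewrite (normc_def z) -/(sqnorm z) -/Z.
  rewrite [leRHS](_ : _ = (n.+1%:R^-1)%:C * Z%:C * s%:C); last first.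
    by rewrite -!rmorphM; congr (_%:C); ring.
  by rewrite ler_wpM2l ?mulr_ge0 ?ler0c ?sqrtr_ge0 ?n0 ?rho_s.
have r0 := char_root_neq0 c_gt0 zr.1.
case: (zr) => _ [[_ rc]|[ze rE]].
  have rp : 0 < sqnorm r by rewrite sqnorm_gt0.
  pose nr := Num.sqrt (sqnorm r).
  have nr0 : 0 < nr by rewrite sqrtr_gt0.
  have nrs : nr < s by rewrite ltr_sqrt.
  pose d := c / nr - s.
  have d0 : 0 < d.
    rewrite subr_gt0 ltr_pdivlMr// -[X in _ < X](sqr_sqrtr (ltW c_gt0)) expr2 -/s.
    by rewrite ltr_pM2l.
  apply: (@clim_squeeze_inv _ _ _ (Z * s / d)) => n.
  rewrite [leRHS](_ : _ = (Z * s * n.+1%:R^-1)%:C / d%:C); last first.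
    by rewrite -fmorphV -rmorphM mulrAC.
  rewrite ler_pdivlMr ?ltcR//; apply: le_trans (E n).
  rewrite ler_wpM2l//.
  rewrite distrC; apply: le_trans (lerB_dist _ _).
  rewrite rmorphB lerB// normrM normfV norm_real (gtr0_norm c_gt0) (normc_def r).
  by rewrite -fmorphV -rmorphM.
have rc : c%:C / r = r.
  have zE := char_rootE c_gt0 zr.1.
  have -> : c%:C / r = - z - r by rewrite [in RHS]zE; ring.
  have -> : z = - (2 * r) by rewrite rE; field.
  ring.
apply: (@clim_squeeze _ _ _ (fun n => Num.sqrt (Z * s * n.+1%:R^-1))) => [n|].
  have := E n; rewrite rc -expr2 sqnormE lecR => En.
  by rewrite normc_def lecR ler_wsqrtr.
have H : (fun n => Z * s * n.+1%:R^-1) @ \oo --> (0 : R).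
  rewrite -[X in _ --> X](mulr0 (Z * s)); apply: cvgM; first exact: cvg_cst.
  exact: cvg_harmonic.
rewrite -(sqrtr0 R); exact: (cvg_comp _ _ H (@sqrt_continuous R 0)).
Qed.

End InnerRootLimit.

(** * Finding the constants and the closed formula for S_mu *)

Section StieltjesFormula.
Variables (R : realType) (c : R) (a b : R[i]) (N : R).
Variable mu : probability (measurableTypeR R) R.
Variable sq : R[i] -> R[i].
Hypotheses (c_gt0 : 0 < c).
Hypotheses (ab_sum_real : a + b \is Num.real) (ab_prod_real : a * b \is Num.real).
Hypothesis N_neq0 : N != 0.
Hypothesis Q_gt0 : forall t : R, - halfwidth c < t < halfwidth c -> 0 < Qpoly N a b t.
Hypothesis mu_density : has_density c N a b mu.
Hypothesis sq_branch : sqrt_branch c sq.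
Implicit Types (w z o r : R[i]) (t : R).

Let D : set (measurableTypeR R) := spec_interval c.
Let S := stieltjes mu.
Local Notation r_ := (rho sq).
Let mD : measurable D := @measurable_spec_interval R c.

Lemma mu_set1 t : mu [set t] = 0%E.
Proof.
rewrite mu_density//; apply: null_set_integral.
- exact: measurableI.
- apply/measurable_EFinP; apply: measurable_funS mD _ _.
    exact: subIsetr.
  exact: measurable_density.
- apply/eqP; rewrite eq_le measure_ge0 andbT -(lebesgue_measure_set1 t).
  by apply: le_measure; rewrite ?inE//; exact: measurableI.
Qed.

(** The integrand (ray z n - z) / (t - ray z n) is bounded by 1 on the cut and tends to 0 except at
    t = z, which is mu-null. Dominated convergence concludes. *)
Lemma stieltjes_edge z : edge c z -> clim (fun n => (ray z n - z) * S (ray z n)) 0.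
Proof.
move=> ze; have [z2 /complex_realP[k zk]] := edgeP c_gt0 ze.
have /complexI k2 : (k ^+ 2)%:C = (4 * c)%:C by rewrite -z2 zk rmorphXn.
pose x n : R := 1 + n.+1%:R^-1.
pose f n t : R := (n.+1%:R^-1 * k) * (t - x n * k)^-1.
have n0 n : 0 < n.+1%:R^-1 :> R by rewrite invr_gt0.
have hk : `|k| = halfwidth c.
  apply/eqP; rewrite -(@eqrXn2 _ 2)// ?ltW ?halfwidth_gt0//.
  by rewrite real_normK ?num_real// k2 sqr_halfwidth.
have k0 : 0 < `|k| by rewrite hk halfwidth_gt0.
have dist n t : D t -> n.+1%:R^-1 * `|k| <= `|t - x n * k|.
  rewrite /D /spec_interval /= in_itv /= -ler_norml -hk => tk.
  rewrite distrC; apply: le_trans (lerB_dist _ _).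
  rewrite normrM gtr0_norm; last by rewrite ltr_wpDl.
  by rewrite /x mulrDl mul1r addrAC -[leLHS]add0r lerD2r subr_ge0.
have distp n t : D t -> 0 < `|t - x n * k|.
  by move=> Dt; rewrite (lt_le_trans _ (dist n t Dt))// mulr_gt0.
have f1 n t : D t -> `|f n t| <= 1.
  move=> Dt; rewrite /f normrM normfV normrM (gtr0_norm (n0 n)).
  by rewrite ler_pdivrMr ?distp// mul1r dist.
have mf n : measurable_fun D (f n).
  apply: measurable_funM => //; apply: (measurableT_comp (@measurable_inv R)).
  by apply: measurable_funB => //; exact: measurable_id.
have SE n : (ray z n - z) * S (ray z n) = (\int[mu]_(t in D) f n t)%:C.
  rewrite ray_sub /S (stieltjesE mu_density).
  rewrite -cintZ; last first.
    have dp : 0 < n.+1%:R^-1 * `|k| by rewrite mulr_gt0.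
    apply: (bounded_meas_inv dp) => t Dt.
    by rewrite /ray zk -rmorphM -rmorphB norm_real lecR; exact: dist.
  rewrite -cint_real; apply: eq_cint => t _.
  by rewrite /ray zk -!rmorphM -rmorphB -fmorphV -rmorphM.
apply: (@clim_squeeze _ _ _ (fun n => `|(\int[mu]_(t in D) f n t)%R|)) => [n|].
  by rewrite subr0 SE norm_real.
have h1 n : measurable_fun D (fun t => (f n t)%:E) by apply/measurable_EFinP; exact: mf.
have h2 : measurable_fun D (cst (0 : \bar R)) by exact: measurable_cst.
have h3 : {ae mu, forall t, D t -> (fun n => (f n t)%:E) @ \oo --> (0%E : \bar R)}.
  exists [set k]; split; [exact: measurable_set1|exact: mu_set1|].
  move=> t /=; apply: contra_notP => tk _.
  apply/fine_cvgP; split; first by near=> n.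
  have tk0 : t - k != 0 by rewrite subr_eq0; apply/eqP.
  have cn : (fun n => n.+1%:R^-1) @ \oo --> (0 : R) by exact: cvg_harmonic.
  rewrite [X in _ --> X](_ : _ = (0 * k) * (t - (1 + 0) * k)^-1); last by rewrite !mul0r.
  apply: cvgM; first by apply: cvgM cn _; exact: cvg_cst.
  apply: cvgV; first by rewrite addr0 mul1r.
  apply: cvgB; first exact: cvg_cst.
  by apply: cvgM; [apply: cvgD cn; exact: cvg_cst|exact: cvg_cst].
have h4 : mu.-integrable D (cst (1%E : \bar R)) by exact: finite_measure_integrable_cst.
have h5 : {ae mu, forall t n, D t -> (`|(f n t)%:E| <= cst 1 t)%E}.
  by apply: aeW => t n Dt; rewrite /= lee_fin f1.
have [_ _ H] := dominated_convergence mD h1 h2 h3 h4 h5.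
have : (fun n => fine (\int[mu]_(t in D) (f n t)%:E)%E) @ \oo --> (0 : R).
  rewrite integral0 in H; exact: (fine_cvg H).
by move/cvg_norm; rewrite normr0; exact.
Unshelve. all: by end_near. Qed.

Lemma stieltjes_inner_root z r : inner_root c z r ->
  clim (fun n => (ray z n - z) * S (ray z n)) 0.
Proof.
case=> _ [[zc _]|[ze _]]; last exact: stieltjes_edge.
have := climM (climB (clim_ray z) (clim_cst z)) (stieltjes_ray c_gt0 mu_density zc).
by rewrite subrr mul0r.
Qed.

Lemma inner_root_neq0 z r : inner_root c z r -> z != 0.
Proof.
case=> _ [[zc _]|[ze _]]; apply/eqP => z0.
  apply: zc; exists 0; rewrite ?z0//; apply/(spec_intervalP c_gt0).
  by rewrite expr0n mulr_ge0// ltW.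
have [/esym/eqP] := edgeP c_gt0 ze; rewrite z0 expr0n /= => E.
by move: E; rewrite (inj_eq (@complexI R) _ 0) mulf_eq0 gt_eqF//= gt_eqF.
Qed.

Lemma ray_neq z r n : inner_root c z r -> ray z n - z != 0.
Proof.
move=> zr; rewrite ray_sub mulf_neq0 ?(inner_root_neq0 zr)//.
by rewrite (inj_eq (@complexI R) _ 0).
Qed.

Variables ra rb : R[i].
Hypotheses (a_ra : inner_root c a ra) (b_rb : inner_root c b rb).
Hypothesis not_double_edge : ~ (a = b /\ edge c a).

Lemma inner_root_sub w r w' r' : char_root c w r -> char_root c w' r' ->
  w - w' = (r - r') * (c%:C - r * r') / (r * r').
Proof.
move=> wr wr'; rewrite (char_rootE c_gt0 wr) (char_rootE c_gt0 wr').
have r0 := char_root_neq0 c_gt0 wr; have r0' := char_root_neq0 c_gt0 wr'.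
by field; rewrite r0 r0'.
Qed.

(* Letting w tend to a and b in [stieltjes_identity] gives the first two equations;
   the third is their divided difference, a derivative when a = b. *)
Lemma stieltjes_constants : exists K m1 : R[i],
  (forall w, ~ branch_cut c w ->
    N%:C * ((w - a) * (w - b)) * S w + N%:C * (m1 + w - a - b) = K * r_ w) /\
  [/\ K * ra = N%:C * (m1 - b), K * rb = N%:C * (m1 - a)
    & K * (ra * rb) = N%:C * (c%:C - ra * rb)].
Proof.
have [K [m1]] :=
  stieltjes_identity c_gt0 ab_sum_real ab_prod_real Q_gt0 mu_density sq_branch.
rewrite -/S => H.
exists K%:C, m1%:C; split => //.
(* Here z is one root of Q and o the other; fixing only their sum and product lets a and b exchange
   roles. *)
have ev z o rz : z + o = a + b -> z * o = a * b -> inner_root c z rz ->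
    K%:C * rz = N%:C * (m1%:C - o).
  move=> zos zop zr.
  have L := clim_rho_ray c_gt0 sq_branch zr.
  have X := stieltjes_inner_root zr; have W := clim_ray z.
  have C (k : R[i]) := clim_cst k.
  have L1 := climM (C K%:C) L.
  have L2 := climD (climM (climM (C N%:C) (climB W (C o))) X)
    (climM (C N%:C) (climB (climB (climD (C m1%:C) W) (C z)) (C o))).
  rewrite (clim_unique L1 L2); first by ring.
  move=> n /=; rewrite -(H _ (inner_root_ray_off c_gt0 (n := n) zr)).
  move: (S (ray z n)) (ray z n) => s w.
  have -> : (w - a) * (w - b) = (w - z) * (w - o).
    transitivity (w ^+ 2 - (a + b) * w + a * b); first by ring.
    by rewrite -zos -zop; ring.
  have -> : m1%:C + w - a - b = m1%:C + w - (a + b) by ring.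
  by rewrite -zos; ring.
have Ea := ev a b ra erefl erefl a_ra.
have Eb := ev b a rb (addrC _ _) (mulrC _ _) b_rb.
split=> //.
have ra0 := char_root_neq0 c_gt0 a_ra.1; have rb0 := char_root_neq0 c_gt0 b_rb.1.
(* A double root lies off the cut by [not_double_edge]. The identity on the ray minus its value at a
   is divided by q - ra, nonzero there, before passing to the limit. *)
have [ab|ab] := eqVneq a b.
  have ae : ~~ edge c a by apply/negP => ae; apply: not_double_edge.
  have aoff : ~ branch_cut c a by case: (a_ra) => _ [[]|[]] //; rewrite (negPf ae).
  have inn z r : inner_root c z r -> ~~ edge c z -> sqnorm r < c.
    by case=> _ [[]|[ze _]] //; rewrite ze.
  have rab : rb = ra.
    have := b_rb.1; rewrite -ab => /(char_root_onto c_gt0 a_ra.1)[//|E].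
    have := sqnorm_inv_root c ra0; rewrite -E => F; exfalso.
    have := inn _ _ a_ra ae; have := inn _ _ b_rb; rewrite -ab => /(_ ae) h1 h2.
    have := sqnorm_ge0 ra; have := sqnorm_ge0 rb; nra.
  rewrite rab; have L := clim_rho_ray c_gt0 sq_branch a_ra.
  have X := stieltjes_inner_root a_ra.
  have C (k : R[i]) := clim_cst k.
  have L1 := climM (C K%:C) (climM (C ra) L).
  have L2 := climM (C N%:C) (climM (climD X (C 1)) (climB (C c%:C) (climM L (C ra)))).
  rewrite (clim_unique L1 L2); first by ring.
  move=> n /=; have off := inner_root_ray_off c_gt0 (n := n) a_ra.
  have := H _ off; rewrite -ab.
  have wr := rho_root sq_branch off.
  have wa := ray_neq n a_ra.
  have := inner_root_sub wr a_ra.1; have q0 := char_root_neq0 c_gt0 wr.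
  move: (S (ray a n)) (rho sq (ray a n)) q0 => s q q0 wE HE.
  have e1 : q - ra != 0.
    by apply: contraNneq wa => qr; rewrite wE qr !mul0r.
  apply: (mulfI e1).
  have -> : (q - ra) * (K%:C * (ra * q)) = (K%:C * q - K%:C * ra) * (ra * q) by ring.
  rewrite -HE Ea -ab.
  have -> : (q - ra) * (N%:C * (((ray a n - a) * s + 1) * (c%:C - q * ra))) =
    N%:C * ((ray a n - a) * s + 1) * ((q - ra) * (c%:C - q * ra) / (q * ra)) * (q * ra).
    by field; rewrite q0 ra0.
  by rewrite -wE; ring.
have e1 : ra - rb != 0.
  apply: contraNneq ab => rab; rewrite -subr_eq0.
  by rewrite (inner_root_sub a_ra.1 b_rb.1) rab !mul0r.
apply: (mulfI e1).
have -> : (ra - rb) * (K%:C * (ra * rb)) = (K%:C * ra - K%:C * rb) * (ra * rb) by ring.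
rewrite Ea Eb.
have -> : (ra - rb) * (N%:C * (c%:C - ra * rb)) =
   N%:C * ((ra - rb) * (c%:C - ra * rb) / (ra * rb)) * (ra * rb).
  by field; rewrite ra0 rb0.
by rewrite -(inner_root_sub a_ra.1 b_rb.1); ring.
Qed.

(** Substituting the constants proves the formula multiplied by (w - a) (w - b). If w is itself a or
    b, this factor vanishes and the formula is recovered as a limit along the ray through w. *)
Lemma stieltjes_formula w : ~ branch_cut c w ->
  S w * ((c%:C - ra * r_ w) * (c%:C - rb * r_ w)) = c%:C * r_ w.
Proof.
have [K [m1 [H [Ea Eb Kab]]]] := stieltjes_constants.
have ra0 := char_root_neq0 c_gt0 a_ra.1; have rb0 := char_root_neq0 c_gt0 b_rb.1.
have NC : N%:C != 0 by rewrite (inj_eq (@complexI R) N 0).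
pose F w := S w * ((c%:C - ra * r_ w) * (c%:C - rb * r_ w)) - c%:C * r_ w.
have F0 v : ~ branch_cut c v -> (v - a) * (v - b) * F v = 0.
  move=> vc; have vr := rho_root sq_branch vc.
  have q0 := char_root_neq0 c_gt0 vr.
  have va := inner_root_sub vr a_ra.1; have vb := inner_root_sub vr b_rb.1.
  have vE := char_rootE c_gt0 vr; have aE := char_rootE c_gt0 a_ra.1.
  have bE := char_rootE c_gt0 b_rb.1.
  have := H v vc; rewrite /F.
  move: (r_ v) (S v) q0 va vb vE => q s q0 va vb vE HE.
  have KE : K = N%:C * (c%:C - ra * rb) / (ra * rb).
    by rewrite -Kab; field; rewrite ra0 rb0.
  have mE : m1 = b + (c%:C - ra * rb) / rb.
    apply: (mulfI NC); rewrite mulrDr.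
    have -> : N%:C * ((c%:C - ra * rb) / rb) = K * ra.
      by rewrite KE; field; rewrite ra0 rb0.
    by rewrite Ea; ring.
  have E1 : (v - a) * (v - b) * s = c%:C * (q - ra) * (q - rb) / (q * (ra * rb)).
    apply: (mulfI NC).
    have -> : N%:C * ((v - a) * (v - b) * s) = K * q - N%:C * (m1 + v - a - b).
      by rewrite -HE; ring.
    rewrite KE mE vE aE.
    by field; rewrite ra0 rb0 q0.
  have -> : (v - a) * (v - b) * (s * ((c%:C - ra * q) * (c%:C - rb * q)) - c%:C * q) =
    (v - a) * (v - b) * s * ((c%:C - ra * q) * (c%:C - rb * q)) -
    (v - a) * (v - b) * (c%:C * q) by ring.
  rewrite E1 va vb.
  by field; rewrite ra0 rb0 q0.
move=> wc; apply/eqP; rewrite -subr_eq0 -/(F w).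
have := F0 w wc => /eqP; rewrite mulf_eq0 => /orP[|//].
have lim_F z r : inner_root c z r -> z = w ->
   clim (fun n => F (ray z n)) (F z).
  move=> zr zw; have := clim_rho_ray c_gt0 sq_branch (off_inner_root c_gt0 sq_branch wc).
  have := stieltjes_ray c_gt0 mu_density wc; rewrite -zw => Ls Lr.
  have C (k : R[i]) := clim_cst k.
  exact: (climB (climM Ls (climM (climB (C c%:C) (climM (C ra) Lr))
    (climB (C c%:C) (climM (C rb) Lr)))) (climM (C c%:C) Lr)).
have key z o r : inner_root c z r ->
    (forall v, (v - a) * (v - b) = (v - z) * (v - o)) -> w - z = 0 -> F w = 0.
  move=> zr ab /eqP; rewrite subr_eq0 => /eqP/esym zw.
  have LF := lim_F _ _ zr zw.
  have FR n : (ray z n - o) * F (ray z n) = 0.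
    apply: (mulfI (ray_neq n zr)); rewrite mulr0 mulrA -ab.
    exact: F0 (inner_root_ray_off c_gt0 (n := n) zr).
  (* The factor [ray z n - o] is nonzero on the ray when o = z; otherwise its limit z - o is
     nonzero. *)
  rewrite -zw; have [zo|zo] := eqVneq z o.
    apply: (clim_unique LF (clim_cst 0)) => n.
    by apply: (mulfI (ray_neq n zr)); rewrite mulr0 -[RHS](FR n) -zo.
  have zo' : z - o != 0 by rewrite subr_eq0.
  apply: (mulfI zo'); rewrite mulr0.
  exact: (clim_unique (climM (climB (clim_ray z) (clim_cst o)) LF) (clim_cst 0)).
rewrite mulf_eq0 => /orP[/eqP wa|/eqP wb]; apply/eqP.
  exact: (key a b ra).
by apply: (key b a rb) => // v; rewrite mulrC.
Qed.

End StieltjesFormula.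

(** * Mixtures of mu with two point masses *)

Section AtomicMixture.
Variables (R : realType) (mu : probability (measurableTypeR R) R).
Variables (k p q : {nonneg R}) (A B : R).
Hypothesis kpq : k%:num + p%:num + q%:num = 1.

Definition mixture : set (measurableTypeR R) -> \bar R :=
  measure_add (mscale k mu)
    (measure_add (mscale p (\d_ (A : measurableTypeR R)))
                 (mscale q (\d_ (B : measurableTypeR R)))).

Lemma mixtureE U : mixture U =
  (k%:num%:E * mu U + (p%:num%:E * \d_A U + q%:num%:E * \d_B U))%E.
Proof.
rewrite /mixture measure_addE; congr (_ + _)%E.
exact: (measure_addE (mscale p _) (mscale q _)).
Qed.

HB.instance Definition _ := Measure.on mixture.

Let mixture_setT : mixture setT = 1%E.
Proof. by rewrite mixtureE probability_setT !diracT !mule1 -!EFinD addrA kpq. Qed.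

HB.instance Definition _ := Measure_isProbability.Build _ _ _ mixture mixture_setT.

Definition mixture_prob : probability (measurableTypeR R) R := mixture.

Let ge0_integral_mixture (f : R -> R) : (forall t, 0 <= f t) ->
  measurable_fun [set: R] f -> mu.-integrable [set: R] (EFin \o f) ->
  (\int[mixture_prob]_t f t)%R =
  k%:num * (\int[mu]_t f t)%R + p%:num * f A + q%:num * f B.
Proof.
move=> f0 mf fint.
have mF : measurable_fun [set: measurableTypeR R] (EFin \o f) by exact/measurable_EFinP.
have F0 t : [set: measurableTypeR R] t -> (0 <= (EFin \o f) t)%E by rewrite lee_fin.
pose dA : {measure set (measurableTypeR R) -> \bar R} := \d_ (A : measurableTypeR R).
pose dB : {measure set (measurableTypeR R) -> \bar R} := \d_ (B : measurableTypeR R).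
have E : (\int[mixture_prob]_t (f t)%:E = k%:num%:E * \int[mu]_t (f t)%:E +
    (p%:num%:E * (f A)%:E + q%:num%:E * (f B)%:E))%E.
  have e1 := ge0_integral_measure_add (mscale k mu)
    (measure_add (mscale p dA) (mscale q dB)) measurableT F0 mF.
  refine (etrans e1 _).
  congr (_ + _)%E; first exact: ge0_integral_mscale.
  apply: etrans
    (ge0_integral_measure_add (mscale p dA) (mscale q dB) measurableT F0 mF) _.
  congr (_ + _)%E.
    rewrite (ge0_integral_mscale dA measurableT _ mF F0) integral_dirac// diracT mul1e//.
  rewrite (ge0_integral_mscale dB measurableT _ mF F0) integral_dirac// diracT mul1e//.
have : (\int[mu]_x (f x)%:E)%E \is a fin_num by exact: integrable_fin_num.
by rewrite /Rintegral E => /fineK <- /=; rewrite addrA.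
Qed.

(** Additivity in the measure is applied to the nonnegative function f + M. The constant M
    integrates to itself under each probability and cancels because the weights sum to 1. *)
Lemma integral_mixture (f : R -> R) (M : R) : (forall t, `|f t| <= M) ->
  measurable_fun [set: R] f ->
  (\int[mixture_prob]_t f t)%R =
  k%:num * (\int[mu]_t f t)%R + p%:num * f A + q%:num * f B.
Proof.
move=> fM mf.
have int (P : probability (measurableTypeR R) R) (g : R -> R) (M' : R) :
    measurable_fun [set: R] g -> (forall t, `|g t| <= M') ->
    P.-integrable [set: R] (EFin \o g).
  move=> mg gM; apply: measurable_bounded_integrable => //.
    by apply: le_lt_trans (ltry 1); exact: probability_le1.
  exists M'; split; first exact: num_real.
  by move=> x /ltW Mx t _; apply: le_trans Mx; exact: gM.
have cM (P : probability (measurableTypeR R) R) : (\int[P]_(t in setT) M)%R = M.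
  by rewrite Rintegral_cst//= (congr1 fine (probability_setT P)) mulr1.
have sh (P : probability (measurableTypeR R) R) :
    (\int[P]_t (f t + M))%R = (\int[P]_t f t)%R + M.
  rewrite RintegralD//; [by rewrite cM|exact: int fM|].
  by apply: (int P (cst M) `|M|) => //; exact: measurable_cst.
have := @ge0_integral_mixture (fun t => f t + M).
rewrite !sh => H; apply: (addIr M); rewrite H.
- by rewrite -[X in _ = _ + X]mul1r -kpq; ring.
- by move=> t; have := fM t; rewrite ler_norml => /andP[+ _]; lra.
- by apply: measurable_funD => //; exact: measurable_cst.
- apply: (int mu _ (M + `|M|)).
    by apply: measurable_funD => //; exact: measurable_cst.
  by move=> t; rewrite (le_trans (ler_normD _ _))// lerD.
Qed.

(** For non-real w the resolvent is bounded by 1 / |Im w| on the whole line, atoms included. *)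
Lemma stieltjes_mixture w : w \isn't Num.real ->
  stieltjes mixture_prob w = (k%:num)%:C * stieltjes mu w
    + (p%:num)%:C * (A%:C - w)^-1 + (q%:num)%:C * (B%:C - w)^-1.
Proof.
move=> wr.
have i0 : complex.Im w != 0 by case: w wr => x y; rewrite complex_real.
have bd t : `|(t%:C - w)^-1| <= (`|complex.Im w|^-1)%:C.
  have h := norm_Im_le_dist w t.
  have h0 : 0 < `|complex.Im w|%:C by rewrite ltcR normr_gt0.
  by rewrite normfV fmorphV lef_pV2 ?posrE// (lt_le_trans h0).
rewrite /stieltjes.
rewrite (@integral_mixture (fun t => complex.Re (t%:C - w)^-1) (`|complex.Im w|^-1));
  last 2 first.
- by move=> t; exact: ler_Re_norm.
- exact: measurable_Re_inv.
rewrite (@integral_mixture (fun t => complex.Im (t%:C - w)^-1) (`|complex.Im w|^-1));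
  last 2 first.
- by move=> t; exact: ler_Im_norm.
- exact: measurable_Im_inv.
case: ((A%:C - w)^-1) => a1 a2; case: ((B%:C - w)^-1) => b1 b2.
by apply/eqP; rewrite eq_complex /= !(mul0r, subr0, addr0, add0r) !eqxx.
Qed.

Lemma mixture_atom : 0 < p%:num -> has_atom mixture_prob.
Proof.
move=> p0; exists A; rewrite /= mixtureE.
apply: lt_le_trans (leeDr _ _); last first.
  by rewrite mule_ge0// lee_fin.
apply: lt_le_trans (leeDl _ _); last by rewrite mule_ge0// lee_fin.
by rewrite diracE mem_set// mule1 lte_fin.
Qed.

End AtomicMixture.

(** * Solutions as pairs of characteristic roots *)

Section SolutionPairs.
Variables (R : realType) (c : R).
Hypothesis c_gt0 : 0 < c.
Implicit Types (a b w u v : R[i]).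

(* The substitution w = - (r + c / r) turns [1 / S w] into
   (c - u r) (c - v r) / (c r), where the zeros of [G0] are - (u + c / u) and
   - (v + c / v). *)
Definition sol_pair u v : R[i] * R[i] := (- (u + v), (1 - u * v / c%:C) / 2).

Let c0 : c%:C != 0 := @cC_neq0 R c c_gt0.

Lemma sol_pairC u v : sol_pair u v = sol_pair v u.
Proof. by rewrite /sol_pair [v + u]addrC [v * u]mulrC. Qed.

Lemma G0_sol_pair a b u v : char_root c a u -> char_root c b v ->
  G0 c (sol_pair u v).1 (sol_pair u v).2 =
  (u * v / c%:C) *: (('X - a%:P) * ('X - b%:P)).
Proof.
move=> au bv; have u0 := char_root_neq0 c_gt0 au; have v0 := char_root_neq0 c_gt0 bv.
have -> : (u * v / c%:C) *: (('X - a%:P) * ('X - b%:P)) =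
   (u * v / c%:C * (a * b))%:P - (u * v / c%:C * (a + b)) *: 'X + (u * v / c%:C) *: 'X^2.
  by rewrite -!mul_polyC !(rmorphM, rmorphD) /=; ring.
rewrite /G0 /=; congr (_%:P - _ *: _ + _ *: _).
- rewrite (char_rootE c_gt0 au) (char_rootE c_gt0 bv); by field; rewrite ?c0 ?u0 ?v0.
- rewrite (char_rootE c_gt0 au) (char_rootE c_gt0 bv); by field; rewrite ?c0 ?u0 ?v0.
- by field; rewrite c0.
Qed.

Lemma solution_sol_pair a b u v : char_root c a u -> char_root c b v ->
  u * v != c%:C -> solution c a b (sol_pair u v).
Proof.
move=> au bv uvc; have u0 := char_root_neq0 c_gt0 au; have v0 := char_root_neq0 c_gt0 bv.
have k0 : u * v / c%:C != 0 by rewrite !mulf_neq0// invr_eq0.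
split.
- rewrite /= mulf_neq0 ?invr_eq0// subr_eq0 eq_sym; apply: contra uvc => /eqP E.
  by rewrite -[u * v](divfK c0) E mul1r.
- rewrite /= -subr_eq0.
  have -> : (1 - u * v / c%:C) / 2 - 2^-1 = - (u * v / c%:C) / 2 by field.
  by rewrite mulf_neq0 ?oppr_eq0 ?invr_eq0.
- rewrite (G0_sol_pair au bv); exact: eqp_scale.
Qed.

(** Take u and v with sum - alpha and product (1 - 2 beta) c. Comparing coefficients of [G0], the
    numbers - (u + c / u) and - (v + c / v) have the same sum and product as a and b, so they are a
    and b in some order. *)
Lemma sol_pair_of_solution a b p : solution c a b p ->
  exists u v, [/\ char_root c a u, char_root c b v & p = sol_pair u v].
Proof.
case: p => al be [/= be0 be2 /eqpP[[k1 k2] /= /andP[k10 k20] E]].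
pose g x := al ^+ 2 + 4 * c%:C * be ^+ 2 - 2 * al * (1 - be) * x + (1 - 2 * be) * x ^+ 2.
have Ex x : k1 * g x = k2 * ((x - a) * (x - b)).
  by have := congr1 (fun p => p.[x]) E; rewrite /G0 /g !hornerE.
have [E1 E2 E3] : [/\ k1 * (al ^+ 2 + 4 * c%:C * be ^+ 2) = k2 * (a * b),
    k1 * (2 * al * (1 - be)) = k2 * (a + b) & k1 * (1 - 2 * be) = k2].
  (* The values at 0, 1 and -1 determine the three coefficients. *)
  have H0 := Ex 0; have H1 := Ex 1; have H2 := Ex (-1).
  split.
  - by move: H0; rewrite /g mulr0 subr0 expr0n mulr0 addr0 !sub0r mulrNN.
  - apply: (@mulfI _ 2) => //.
    transitivity (k1 * g (-1) - k1 * g 1); first by rewrite /g; ring.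
    by rewrite H1 H2; ring.
  - apply: (@mulfI _ 2) => //.
    transitivity (k1 * g (-1) + k1 * g 1 - 2 * (k1 * g 0)); first by rewrite /g; ring.
    by rewrite H0 H1 H2; ring.
pose ga := 1 - 2 * be.
have ga0 : ga != 0.
  rewrite subr_eq0 eq_sym; apply: contra be2 => /eqP h.
  by rewrite -[be](mulKf (_ : 2 != 0)) ?h ?mulr1.
have beE : be = (1 - ga) / 2 by rewrite /ga; field.
pose d := sqrtc (al ^+ 2 - 4 * ga * c%:C).
have d2 : d ^+ 2 = al ^+ 2 - 4 * ga * c%:C := sqr_sqrtc _.
pose u := (- al + d) / 2; pose v := (- al - d) / 2.
have uv : u * v = ga * c%:C.
  have -> : u * v = (al ^+ 2 - d ^+ 2) / 4 by rewrite /u /v; field.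
  by rewrite d2; field.
have alE : al = - (u + v) by rewrite /u /v; field.
have uv0 : u * v != 0 by rewrite uv mulf_neq0.
have /andP[u0 v0] : (u != 0) && (v != 0) by move: uv0; rewrite mulf_eq0 negb_or.
have gaE : ga = u * v / c%:C by rewrite uv mulfK.
have pE : (al, be) = sol_pair u v by rewrite /sol_pair -alE -gaE beE.
have S : - (u + c%:C / u) + - (v + c%:C / v) = a + b.
  apply: (mulfI k20); rewrite -E2 -E3 -/ga beE gaE alE.
  by field; rewrite c0 u0 v0.
have P : (u + c%:C / u) * (v + c%:C / v) = a * b.
  apply: (mulfI k20); rewrite -E1 -E3 -/ga beE gaE alE.
  by field; rewrite c0 u0 v0.
have rt z y : y != 0 -> z = - (y + c%:C / y) -> char_root c z y.
  by move=> y0 ->; apply/eqP; field.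
have : (- (u + c%:C / u) - a) * (- (u + c%:C / u) - b) = 0.
  transitivity ((u + c%:C / u) ^+ 2 + (u + c%:C / u) * (a + b) + a * b); first by ring.
  by rewrite -S -P; ring.
move/eqP; rewrite mulf_eq0 !subr_eq0 => /orP[/eqP h|/eqP h].
  exists u, v; split => //; apply: rt => //.
  by apply: (addrI a); rewrite -S h.
exists v, u; rewrite sol_pairC; split => //; apply: rt => //.
by apply: (addIr b); rewrite -S h addrC.
Qed.

Lemma shiftS_sol_pair (sq : R[i] -> R[i]) u v w : sqrt_branch c sq -> ~ branch_cut c w ->
  shiftS sq (sol_pair u v) w =
  c%:C * rho sq w / ((c%:C - u * rho sq w) * (c%:C - v * rho sq w)).
Proof.
move=> sqb wc; have wr := rho_root sqb wc.
have r0 := char_root_neq0 c_gt0 wr.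
rewrite /shiftS /sol_pair /= -[RHS]invrK invf_div; congr (_^-1).
rewrite {1}(char_rootE c_gt0 wr); move: (rho sq w) r0 => r r0.
by field; rewrite c0 r0.
Qed.

Lemma sol_pair_inj u v u' v' : sol_pair u v = sol_pair u' v' ->
  u + v = u' + v' /\ u * v = u' * v'.
Proof.
move=> /pair_equal_spec[/oppr_inj -> h]; split => //.
have : 1 - 2 * ((1 - u * v / c%:C) / 2) = 1 - 2 * ((1 - u' * v' / c%:C) / 2) by rewrite h.
have e x y : 1 - 2 * ((1 - x * y / c%:C) / 2) = x * y / c%:C by field.
by rewrite !e => /(divIf c0).
Qed.

End SolutionPairs.

(** * Positivity, conjugation and uniqueness of inner roots *)

Section PositivePairs.
Variables (R : realType) (c : R).
Hypothesis c_gt0 : 0 < c.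
Implicit Types (a b z w u v r : R[i]) (x y : R).

Lemma positive_sol_pair a b u v : char_root c a u -> char_root c b v ->
  positive_solution c a b (sol_pair c u v) <-> (u + v \is Num.real /\ u * v < c%:C).
Proof.
move=> au bv; have cC : 0 < c%:C by rewrite ltcR.
have betaE : (0 < (sol_pair c u v).2) = (u * v < c%:C).
  by rewrite /= pmulr_lgt0 ?invr_gt0 ?ltr0n// subr_gt0 ltr_pdivrMr// mul1r.
have alE : ((sol_pair c u v).1 \is Num.real) = (u + v \is Num.real) by rewrite /= realN.
split=> [[_]|[h1 h2]]; first by rewrite betaE alE.
split; rewrite ?betaE ?alE//.
by apply: solution_sol_pair => //; rewrite lt_eqF.
Qed.

Lemma positive_solutionE a b ra rb p : char_root c a ra -> char_root c b rb ->
  positive_solution c a b p -> exists u v,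
  [/\ u = ra \/ u = c%:C / ra, v = rb \/ v = c%:C / rb, u + v \is Num.real,
      u * v < c%:C & p = sol_pair c u v].
Proof.
move=> ara brb [/[dup] ps /(sol_pair_of_solution c_gt0)[u [v [au bv pE]]] pr p0].
exists u, v; have [h1 h2] : u + v \is Num.real /\ u * v < c%:C.
  by apply/(positive_sol_pair au bv); rewrite -pE.
by split => //; [exact: (char_root_onto c_gt0 ara)|exact: (char_root_onto c_gt0 brb)].
Qed.

Lemma edge_cut z : edge c z -> branch_cut c z.
Proof.
move=> ze; have [z2 /complex_realP[k zk]] := edgeP c_gt0 ze.
exists k => //; apply/(spec_intervalP c_gt0).
by have /complexI -> : (k ^+ 2)%:C = (4 * c)%:C by rewrite -z2 zk rmorphXn.
Qed.

Lemma inner_root_sqnorm z r : inner_root c z r ->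
  if edge c z then sqnorm r = c else sqnorm r < c.
Proof.
case=> _ [[zc rc]|[ze ->]].
  by case: ifPn => // /edge_cut.
rewrite ze; have [z2 /complex_realP[k zk]] := edgeP c_gt0 ze.
have /complexI k2 : (k ^+ 2)%:C = (4 * c)%:C by rewrite -z2 zk rmorphXn.
have -> : - z / 2 = (- k / 2)%:C by rewrite zk rmorphM rmorphN fmorphV rmorph_nat.
rewrite /sqnorm /= expr0n addr0.
by have -> : (- k / 2) ^+ 2 = k ^+ 2 / 4; [field|rewrite k2; field].
Qed.

(** The two characteristic roots have product c, so they cannot both have modulus below sqrt c. *)
Lemma inner_root_unique z r r' : char_root c z r -> char_root c z r' ->
  sqnorm r < c -> sqnorm r' < c -> r' = r.
Proof.
move=> zr zr' rc r'c; have [//|E] := char_root_onto c_gt0 zr zr'.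
have := sqnorm_inv_root c (char_root_neq0 c_gt0 zr); rewrite -E.
by move=> h; have := ltr_pM (sqnorm_ge0 r') (sqnorm_ge0 r) r'c rc; rewrite h -expr2 ltxx.
Qed.

Lemma sqnormJ z : sqnorm z^*%C = sqnorm z.
Proof. by case: z => x y; rewrite /sqnorm /= sqrrN. Qed.

Lemma char_rootJ z r : char_root c z r -> char_root c z^*%C r^*%C.
Proof.
move=> /eqP E; apply/eqP.
have -> : r^*%C ^+ 2 + z^*%C * r^*%C + c%:C = (r ^+ 2 + z * r + c%:C)^*%C.
  by rewrite -{1}(conjc_real c) !expr2 -!rmorphM -!rmorphD.
by rewrite E conjc0.
Qed.

(** For z real and off the cut, the conjugate of r is again an inner root of z, hence equals r. *)
Lemma inner_root_real z r : z \is Num.real -> inner_root c z r -> r \is Num.real.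
Proof.
move=> zR [zr [[zc rc]|[_ ->]]]; last by rewrite realM ?realN// realV realn.
have /complex_realP[k zk] := zR.
have zJ : z^*%C = z by rewrite zk conjc_real.
have := char_rootJ zr; rewrite zJ => zr'.
have := inner_root_unique zr zr' rc; rewrite sqnormJ => /(_ rc).
case: r {zr zc rc zr'} => x y [] /eqP; rewrite -subr_eq0 -opprD oppr_eq0.
by rewrite -mulr2n mulrn_eq0 /= complex_real.
Qed.

End PositivePairs.

(** * Probability measures with atoms behind the extra solutions *)

Section AtomicSolutions.
Variables (R : realType) (c : R) (mu : probability (measurableTypeR R) R).
Variable sq : R[i] -> R[i].
Hypothesis c_gt0 : 0 < c.
Hypothesis sq_branch : sqrt_branch c sq.
Variables x y : R.
Hypothesis stieltjes_mu : forall w, ~ branch_cut c w ->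
  stieltjes mu w * ((c%:C - x%:C * rho sq w) * (c%:C - y%:C * rho sq w)) =
  c%:C * rho sq w.
Hypotheses (x_neq0 : x != 0) (y_neq0 : y != 0).
Hypothesis xy_lt : x * y < c.

(** The real point whose characteristic roots are u and c / u; the atoms sit at such points. *)
Let node (u : R) : R := - (u + c / u).

Let C_neq0 (u : R) : u != 0 -> u%:C != 0.
Proof. by move=> u0; rewrite (inj_eq (@complexI R) u 0). Qed.

Let nodeE (u : R) : (node u)%:C = - (u%:C + c%:C / u%:C).
Proof. by rewrite /node rmorphN rmorphD rmorphM fmorphV. Qed.

Let node_resolvent (u : R) w : u != 0 -> w \isn't Num.real ->
  [/\ u%:C - rho sq w != 0, c%:C - u%:C * rho sq w != 0
   & ((node u)%:C - w)^-1 =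
     (u%:C * rho sq w) / ((u%:C - rho sq w) * (c%:C - u%:C * rho sq w))].
Proof.
move=> u0 wr; have wc := nonreal_off (c := c) wr.
have rt := rho_root sq_branch wc; have r0 := char_root_neq0 c_gt0 rt.
have wE := char_rootE c_gt0 rt; have uC := C_neq0 u0.
move: (rho sq w) rt r0 wE => r rt r0 wE.
have nw : (node u)%:C - w != 0.
  rewrite subr_eq0; apply/eqP => nw; move: wr; rewrite -nw => /negP; apply.
  by apply/complex_realP; exists (node u).
have E : (node u)%:C - w = (u%:C - r) * (c%:C - u%:C * r) / (u%:C * r).
  by rewrite nodeE wE; field; rewrite r0 uC.
have [e1 e2] : u%:C - r != 0 /\ c%:C - u%:C * r != 0.
  by split; apply: contraNneq nw => h; rewrite E h ?(mul0r, mulr0).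
by split => //; rewrite E invf_div.
Qed.

(** Exchanging x for c / x creates a pole at [node x]. The first hypothesis makes its mass positive,
    the second the mass left to mu; the second is also (c / x) y < c, the positivity of beta. *)
Lemma atomic_one : x ^+ 2 < c -> x * y < x ^+ 2 ->
  exists nu : probability (measurableTypeR R) R,
    (forall w, w \isn't Num.real ->
       shiftS sq (sol_pair c (c%:C / x%:C) y%:C) w = stieltjes nu w) /\ has_atom nu.
Proof.
move=> xc xyx; have d0 : 0 < c - x * y by rewrite subr_gt0.
have k0 : 0 <= (x ^+ 2 - x * y) / (c - x * y) by rewrite divr_ge0 ?ltW// subr_gt0.
have p0 : 0 <= (c - x ^+ 2) / (c - x * y) by rewrite divr_ge0 ?ltW// subr_gt0.
have s1 : (NngNum k0)%:num + (NngNum p0)%:num + (0%:nng : {nonneg R})%:num = 1.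
  by rewrite /= addr0; field; rewrite gt_eqF.
(* The weights are minus the residues of the transform at its poles. *)
exists (mixture_prob mu (node x) 0 s1); split; last first.
  by apply: mixture_atom; rewrite /= divr_gt0// subr_gt0.
move=> w wr; rewrite stieltjes_mixture//= mul0r addr0.
have wc := nonreal_off (c := c) wr.
rewrite (shiftS_sol_pair c_gt0 _ _ sq_branch wc).
have [e1 e2 ->] := node_resolvent x_neq0 wr.
have [_ e3 _] := node_resolvent y_neq0 wr.
have := stieltjes_mu wc; have r0 := char_root_neq0 c_gt0 (rho_root sq_branch wc).
move: (rho sq w) e1 e2 e3 r0 => r e1 e2 e3 r0 /(canRL (mulfK (mulf_neq0 e2 e3))) ->.
have xC := C_neq0 x_neq0; have cC := cC_neq0 c_gt0.
have dC : c%:C - x%:C * y%:C != 0.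
  by rewrite -rmorphM -rmorphB (inj_eq (@complexI R) _ 0) gt_eqF.
rewrite !(rmorphM, rmorphB, fmorphV, rmorphXn) /=.
have e4 : c%:C - c%:C / x%:C * r != 0.
  have -> : c%:C - c%:C / x%:C * r = c%:C * (x%:C - r) / x%:C by field.
  by rewrite !mulf_neq0 ?invr_eq0.
field; rewrite ?dC ?e1 ?e2 ?e3 ?xC ?cC /=.
by rewrite -mulrBr mulf_neq0.
Qed.

(** Both nodes are now poles. Their masses are minus the residues, and - x y / c is what they leave
    of the total mass 1. The opposite signs of x and y make all three positive. *)
Lemma atomic_two : x ^+ 2 < c -> y ^+ 2 < c -> x * y < 0 ->
  exists nu : probability (measurableTypeR R) R,
    (forall w, w \isn't Num.real ->
       shiftS sq (sol_pair c (c%:C / x%:C) (c%:C / y%:C)) w = stieltjes nu w) /\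
    has_atom nu.
Proof.
move=> xc yc xy0.
have xy_neq : x - y != 0.
  by rewrite subr_eq0; apply/eqP => xy; move: xy0; rewrite xy -expr2 ltNge sqr_ge0.
have cN : c != 0 by rewrite gt_eqF.
have sgn (s t : R) : s * t < 0 -> 0 < t / (t - s).
  move=> st; have t0 : t != 0 by apply: contraTneq st => ->; rewrite mulr0 ltxx.
  have -> : t / (t - s) = t ^+ 2 / (t ^+ 2 - s * t).
    have d : t - s != 0.
      by rewrite subr_eq0; apply/eqP => ts; move: st; rewrite ts -expr2 ltNge sqr_ge0.
    have -> : t ^+ 2 - s * t = t * (t - s) by ring.
    by field; rewrite t0 d.
  have t2 : 0 < t ^+ 2 by rewrite exprn_even_gt0.
  by rewrite divr_gt0// subr_gt0 (lt_trans st).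
have k0 : 0 <= - (x * y) / c by rewrite divr_ge0 ?ltW// oppr_gt0.
have p0 : 0 < y / (y - x) * (1 - x ^+ 2 / c).
  by rewrite mulr_gt0 ?sgn// subr_gt0 ltr_pdivrMr// mul1r.
have q0 : 0 < x / (x - y) * (1 - y ^+ 2 / c).
  have yx0 : y * x < 0 by rewrite mulrC.
  by rewrite mulr_gt0 ?(sgn _ _ yx0)// subr_gt0 ltr_pdivrMr// mul1r.
have yx_neq : y - x != 0 by rewrite -opprB oppr_eq0.
have s1 : (NngNum k0)%:num + (NngNum (ltW p0))%:num + (NngNum (ltW q0))%:num = 1.
  by rewrite /=; field; rewrite cN xy_neq yx_neq.
exists (mixture_prob mu (node x) (node y) s1); split; last by apply: mixture_atom.
move=> w wr; rewrite stieltjes_mixture//=.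
have wc := nonreal_off (c := c) wr.
rewrite (shiftS_sol_pair c_gt0 _ _ sq_branch wc).
have [e1 e2 ->] := node_resolvent x_neq0 wr.
have [e1' e3 ->] := node_resolvent y_neq0 wr.
have := stieltjes_mu wc; have r0 := char_root_neq0 c_gt0 (rho_root sq_branch wc).
move: (rho sq w) e1 e1' e2 e3 r0 => r e1 e1' e2 e3 r0.
move=> /(canRL (mulfK (mulf_neq0 e2 e3))) ->.
have xC := C_neq0 x_neq0; have yC := C_neq0 y_neq0; have cC := cC_neq0 c_gt0.
have xyC := C_neq0 xy_neq; have yxC := C_neq0 yx_neq.
rewrite !rmorphB /= in xyC yxC.
rewrite !(rmorphM, rmorphB, rmorphN, rmorph1, fmorphV, rmorphXn) /=.
have e4 (s : R[i]) : s != 0 -> s - r != 0 -> c%:C - c%:C / s * r != 0.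
  move=> s0 sr; have -> : c%:C - c%:C / s * r = c%:C * (s - r) / s by field.
  by rewrite !mulf_neq0 ?invr_eq0.
field; rewrite ?e1 ?e1' ?e2 ?e3 ?xC ?yC ?cC ?xyC ?yxC /=.
by rewrite -!mulrBr !mulf_neq0.
Qed.

End AtomicSolutions.

(** * Counting the positive solutions for real roots *)

Lemma card_eq_three (T : choiceType) (p q r : T) :
  p <> q -> p <> r -> q <> r -> ([set t | [\/ t = p, t = q | t = r]] #= `I_3)%card.
Proof.
move=> pq pr qr; pose f i := if i is i'.+1 then if i' is _.+1 then r else q else p.
have -> : [set t | [\/ t = p, t = q | t = r]] = f @` `I_3.
  apply/seteqP; split=> t /=.
    by case=> ->; [exists 0%N|exists 1%N|exists 2%N].
  by case=> [[|[|[|//]]]] _ <-; [exact: Or31|exact: Or32|exact: Or33].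
apply: inj_card_eq => i j; rewrite !inE /=.
by case: i => [|[|[|//]]] _; case: j => [|[|[|//]]] _ //= /esym // /esym.
Qed.

Section RealRoots.
Variables (R : realType) (c x y : R) (a b : R[i]).
Hypothesis c_gt0 : 0 < c.
Hypotheses (x_neq0 : x != 0) (y_neq0 : y != 0).
Hypotheses (ax : char_root c a x%:C) (b_y : char_root c b y%:C).
Hypotheses (x_le : x ^+ 2 <= c) (y_le : y ^+ 2 <= c).

Local Notation rp u v := (sol_pair c u%:C v%:C).

Lemma real_sol_pair_eq (u v u' v' : R) :
  rp u v = rp u' v' -> u + v = u' + v' /\ u * v = u' * v'.
Proof.
move=> /(sol_pair_inj c_gt0)[]; rewrite -!rmorphD -!rmorphM.
by move=> /complexI -> /complexI ->.
Qed.

Let rinv (u : R) : c%:C / u%:C = (c / u)%:C.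
Proof. by rewrite rmorphM fmorphV. Qed.

Let c_neq0 : c != 0. Proof. by rewrite gt_eqF. Qed.

Let real_posP (u v : R) : char_root c a u%:C -> char_root c b v%:C ->
  positive_solution c a b (rp u v) <-> u * v < c.
Proof.
move=> au bv; rewrite (positive_sol_pair c_gt0 au bv) -rmorphD -rmorphM ltcR.
by split=> [[]//|->]; split => //; apply/complex_realP; exists (u + v).
Qed.

Let ax' : char_root c a (c / x)%:C.
Proof. by rewrite -rinv; exact: char_root_inv. Qed.

Let by' : char_root c b (c / y)%:C.
Proof. by rewrite -rinv; exact: char_root_inv. Qed.

(** Clearing denominators with a square spares a case distinction on signs. *)
Let lt10 : (c / x * y < c) = (x * y < x ^+ 2).
Proof.
have x2 : 0 < x ^+ 2 by rewrite exprn_even_gt0.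
rewrite -(ltr_pM2r x2) -[RHS](ltr_pM2l c_gt0).
by congr (_ < _); field.
Qed.

Let lt01 : (x * (c / y) < c) = (x * y < y ^+ 2).
Proof.
have y2 : 0 < y ^+ 2 by rewrite exprn_even_gt0.
rewrite -(ltr_pM2r y2) -[RHS](ltr_pM2l c_gt0).
by congr (_ < _); field.
Qed.

Let lt11 : (c / x * (c / y) < c) = (c * (x * y) < (x * y) ^+ 2).
Proof.
have xy2 : 0 < (x * y) ^+ 2 by rewrite exprn_even_gt0// mulf_neq0.
rewrite -(ltr_pM2r xy2) -[RHS](ltr_pM2l c_gt0).
by congr (_ < _); field; rewrite x_neq0 y_neq0.
Qed.

Lemma extra_realP p : extra_solutions c a b (rp x y) p <->
  p <> rp x y /\ [\/ p = rp (c / x) y /\ x * y < x ^+ 2,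
                     p = rp x (c / y) /\ x * y < y ^+ 2
                   | p = rp (c / x) (c / y) /\ c * (x * y) < (x * y) ^+ 2].
Proof.
rewrite -lt10 -lt01 -lt11; split.
  move=> [/[dup] ps /(positive_solutionE c_gt0 ax b_y)[u [v [uE vE _ uv pE]]] pne].
  split => //.
  move: uv pE {ps} pne; case: uE => ->; case: vE => ->; rewrite ?rinv -rmorphM ltcR.
  - by move=> _ -> /(_ erefl).
  - by move=> h ->; constructor 2.
  - by move=> h ->; constructor 1.
  - by move=> h ->; constructor 3.
case=> pne h; split => //; case: h => -[-> h].
- exact/(real_posP ax' b_y).
- exact/(real_posP ax by').
- exact/(real_posP ax' by').
Qed.

Hypothesis corner : ~ (x = y /\ x ^+ 2 = c).

(** If x y >= c, then (x - y)^2 <= 2 c - 2 x y <= 0, so x = y and x^2 = c, which [corner]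
    excludes. *)
Lemma real_pos_main : x * y < c.
Proof.
have [xy|xy] := ltP (x * y) c; first by [].
exfalso; apply: corner.
have h : (x - y) ^+ 2 <= 0.
  have -> : (x - y) ^+ 2 = x ^+ 2 + y ^+ 2 - 2 * (x * y) by ring.
  by move: x_le y_le xy; move: (x ^+ 2) (y ^+ 2) (x * y) => A B C; lra.
have xE : x = y.
  by apply/eqP; rewrite -subr_eq0 -sqrf_eq0 eq_le h sqr_ge0.
split => //; apply/eqP; rewrite eq_le x_le /=.
by move: xy; rewrite -xE.
Qed.

Let ne10 : x ^+ 2 != c -> rp (c / x) y <> rp x y.
Proof.
move=> /eqP xc /real_sol_pair_eq[+ _] => /addIr E; apply: xc.
by rewrite expr2 -{1}E divfK.
Qed.

Let ne01 : y ^+ 2 != c -> rp x (c / y) <> rp x y.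
Proof.
move=> /eqP yc /real_sol_pair_eq[+ _] => /addrI E; apply: yc.
by rewrite expr2 -{1}E divfK.
Qed.

Let lt_sq (u : R) : u ^+ 2 <= c -> u ^+ 2 != c -> u ^+ 2 < c.
Proof. by move=> h1 h2; rewrite lt_neqAle h2. Qed.

Let edge_inv (u : R) : u != 0 -> u ^+ 2 = c -> c / u = u.
Proof. by move=> u0 <-; rewrite expr2 mulfK. Qed.

Section PositiveProduct.
Hypothesis xy_gt0 : 0 < x * y.

Let no11 : (c * (x * y) < (x * y) ^+ 2) = false.
Proof. by apply/negbTE; rewrite -leNgt expr2 ler_pM2r// ltW// real_pos_main. Qed.

Let sq_ltl : (x * y < x ^+ 2) = (y ^+ 2 < x ^+ 2).
Proof.
have x2 : 0 < x ^+ 2 by rewrite exprn_even_gt0.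
rewrite -[LHS]ltr_sqr ?nnegrE ?(ltW xy_gt0) ?(ltW x2)// exprMn.
by rewrite [(x ^+ 2) ^+ 2]expr2 ltr_pM2l.
Qed.

Let sq_ltr : (x * y < y ^+ 2) = (x ^+ 2 < y ^+ 2).
Proof.
have y2 : 0 < y ^+ 2 by rewrite exprn_even_gt0.
rewrite -[LHS]ltr_sqr ?nnegrE ?(ltW xy_gt0) ?(ltW y2)// exprMn.
by rewrite [(y ^+ 2) ^+ 2]expr2 ltr_pM2r.
Qed.

Let sq_eq : x ^+ 2 = y ^+ 2 -> x = y.
Proof.
move/eqP; rewrite eqf_sqr => /orP[/eqP//|/eqP xy].
by move: xy_gt0; rewrite xy mulNr oppr_gt0 -expr2 ltNge sqr_ge0.
Qed.

(** Exchanging both roots would require x y > c. Exchanging a single one is admissible exactly when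
    it has the larger modulus, and x, y of equal sign and distinct have distinct moduli. *)
Lemma card_extra_pos : x != y -> x ^+ 2 != c -> y ^+ 2 != c ->
  (extra_solutions c a b (rp x y) #= `I_1)%card.
Proof.
move=> xy xc yc.
have [h|h|h] := ltgtP (x ^+ 2) (y ^+ 2).
- rewrite (_ : extra_solutions _ _ _ _ = [set rp x (c / y)]); first exact: card_set1.
  apply/seteqP; split => p /=.
    move/extra_realP; rewrite no11 sq_ltl sq_ltr h ltNge (ltW h).
    by case=> _ [[]|[]|[]].
  move=> ->; apply/extra_realP; split; first exact: ne01.
  by constructor 2; rewrite sq_ltr.
- rewrite (_ : extra_solutions _ _ _ _ = [set rp (c / x) y]); first exact: card_set1.
  apply/seteqP; split => p /=.
    move/extra_realP; rewrite no11 sq_ltl sq_ltr h [x ^+ 2 < _]ltNge (ltW h).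
    by case=> _ [[]|[]|[]].
  move=> ->; apply/extra_realP; split; first exact: ne10.
  by constructor 1; rewrite sq_ltl.
- by move: xy; rewrite (sq_eq h) eqxx.
Qed.

(** Either the moduli agree and no exchange is admissible, or the root of larger modulus belongs to
    an end point and its exchange returns the same pair. *)
Lemma extra_pos_degenerate : [\/ x = y, x ^+ 2 = c | y ^+ 2 = c] ->
  extra_solutions c a b (rp x y) = set0.
Proof.
move=> deg; apply/seteqP; split => // p /extra_realP[pne].
rewrite no11 sq_ltl sq_ltr => -[[pE h]|[pE h]|[]//].
- case: deg => [xy|xc|yc].
  + by move: h; rewrite xy ltxx.
  + by apply: pne; rewrite pE edge_inv.
  + by move: h; rewrite yc ltNge x_le.
- case: deg => [xy|xc|yc].
  + by move: h; rewrite xy ltxx.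
  + by move: h; rewrite xc ltNge y_le.
  + by apply: pne; rewrite pE edge_inv.
Qed.

End PositiveProduct.

Section NegativeProduct.
Hypothesis xy_lt0 : x * y < 0.

Let yes10 : x * y < x ^+ 2. Proof. by rewrite (lt_le_trans xy_lt0)// sqr_ge0. Qed.
Let yes01 : x * y < y ^+ 2. Proof. by rewrite (lt_le_trans xy_lt0)// sqr_ge0. Qed.
Let yes11 : c * (x * y) < (x * y) ^+ 2.
Proof. by rewrite (@lt_le_trans _ _ 0) ?sqr_ge0// pmulr_rlt0. Qed.

Let extraE p : extra_solutions c a b (rp x y) p <->
  p <> rp x y /\ [\/ p = rp (c / x) y, p = rp x (c / y) | p = rp (c / x) (c / y)].
Proof.
rewrite extra_realP; split; case=> h1 h2; split => //.
  by case: h2 => -[]; [constructor 1|constructor 2|constructor 3].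
by case: h2; [constructor 1|constructor 2|constructor 3].
Qed.

(** For x y < 0 every exchange is admissible, so the count rests on the distinctness of the four
    pairs. *)
Lemma card_extra_neg : x ^+ 2 != c -> y ^+ 2 != c ->
  (extra_solutions c a b (rp x y) #= `I_3)%card.
Proof.
move=> xc yc.
have ne11 : rp (c / x) (c / y) <> rp x y.
  move=> /real_sol_pair_eq[_ h].
  have E : (x * y) ^+ 2 = c ^+ 2.
    by rewrite expr2 -{1}h; field; rewrite x_neq0 y_neq0.
  have : (x * y) ^+ 2 < c ^+ 2.
    by rewrite exprMn [c ^+ 2]expr2 ltr_pM ?sqr_ge0 ?lt_sq.
  by rewrite E ltxx.
have -> : extra_solutions c a b (rp x y) =
    [set t | [\/ t = rp (c / x) y, t = rp x (c / y) | t = rp (c / x) (c / y)]].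
  apply/seteqP; split => p /=; first by move/extraE => [].
  move=> h; apply/extraE; split => //.
  by case: h => ->; [exact: ne10|exact: ne01|exact: ne11].
apply: card_eq_three.
(* Equal products give x^2 = y^2, hence y = - x by the signs; equal sums then give c / x = x,
   against x^2 != c. *)
- move=> /real_sol_pair_eq[h1 h2].
  have E : (y - x) * (y + x) = 0.
    have -> : (y - x) * (y + x) = (c / x * y - x * (c / y)) * (x * y) / c.
      by field; rewrite x_neq0 y_neq0 c_neq0.
    by rewrite h2 subrr !mul0r.
  have yE : y = - x.
    move/eqP: E; rewrite mulf_eq0 subr_eq0 addr_eq0 => /orP[/eqP yx|/eqP//].
    by move: xy_lt0; rewrite yx -expr2 ltNge sqr_ge0.
  have h : c / x = x.
    by move: h1; rewrite yE invrN mulrN; move: (c / x) => t ht; lra.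
  by move/eqP: xc; apply; rewrite expr2 -{1}h divfK.
- move=> /real_sol_pair_eq[/addrI h _]; move/eqP: yc; apply.
  by rewrite expr2 {1}h divfK.
- move=> /real_sol_pair_eq[/addIr h _]; move/eqP: xc; apply.
  by rewrite expr2 {1}h divfK.
Qed.

(** As c / x = x, exchanging x has no effect, and the three choices reduce to the exchange of y. *)
Lemma extra_neg_edgel : x ^+ 2 = c -> y ^+ 2 != c ->
  (extra_solutions c a b (rp x y) #= `I_1)%card.
Proof.
move=> xc yc; rewrite (_ : extra_solutions _ _ _ _ = [set rp x (c / y)]).
  exact: card_set1.
apply/seteqP; split => p /=.
  by move/extraE; rewrite (edge_inv x_neq0 xc) => -[ne []].
by move=> ->; apply/extraE; split; [exact: ne01|constructor 2].
Qed.

Lemma extra_neg_edger : x ^+ 2 != c -> y ^+ 2 = c ->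
  (extra_solutions c a b (rp x y) #= `I_1)%card.
Proof.
move=> xc yc; rewrite (_ : extra_solutions _ _ _ _ = [set rp (c / x) y]).
  exact: card_set1.
apply/seteqP; split => p /=.
  by move/extraE; rewrite (edge_inv y_neq0 yc) => -[ne []].
by move=> ->; apply/extraE; split; [exact: ne10|constructor 1].
Qed.

Lemma extra_neg_edges : x ^+ 2 = c -> y ^+ 2 = c ->
  extra_solutions c a b (rp x y) = set0.
Proof.
move=> xc yc; apply/seteqP; split => // p /extraE.
by rewrite (edge_inv x_neq0 xc) (edge_inv y_neq0 yc) => -[ne []] /ne.
Qed.

End NegativeProduct.
End RealRoots.

(** * Uniqueness, the non-real case and the final assembly *)

Section Assembly.
Variables (R : realType) (c : R) (sq : R[i] -> R[i]).
Hypothesis c_gt0 : 0 < c.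
Hypothesis sq_branch : sqrt_branch c sq.
Implicit Types (a b w z r : R[i]).

Lemma positive_root_off N a b z :
  (forall t : R, - halfwidth c < t < halfwidth c -> 0 < Qpoly N a b t) ->
  z = a \/ z = b -> ~ branch_cut c z \/ edge c z.
Proof.
move=> Q_gt0 zab; have [[t It tz]|] := pselect (branch_cut c z); last by left.
right; have [/Q_gt0|tI] := boolP (- halfwidth c < t < halfwidth c).
  by rewrite /Qpoly tz; case: zab => <-; rewrite subrr ?(mulr0, mul0r) ltxx.
move: It tI; rewrite /spec_interval /= in_itv /= => /andP[t1 t2].
rewrite negb_and -!leNgt /edge -tz => /orP[h|h].
  by apply/orP; right; rewrite (inj_eq (@complexI R)) eq_le h t1.
by apply/orP; left; rewrite (inj_eq (@complexI R)) eq_le h t2.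
Qed.

Lemma conj_roots a b : a + b \is Num.real -> a * b \is Num.real ->
  a \isn't Num.real -> b = a^*%C.
Proof.
case: a b => [p q] [p' q']; rewrite !complex_real /= => /eqP h1 /eqP h2 q0.
have qE : q' = - q by apply/eqP; rewrite -addr_eq0 addrC h1.
have : q * (p' - p) = 0 by rewrite -h2 qE; ring.
by move/eqP; rewrite mulf_eq0 (negPf q0) /= subr_eq0 qE => /eqP ->.
Qed.

(** Equal transforms make the difference of the alphas equal to 2 rho(w) times the difference of the
    betas. Since w can be read off from rho(w), the values of rho at i and 2 i differ, so both
    differences vanish. *)
Lemma shiftS_inj (p q : R[i] * R[i]) :
  (forall w, ~ branch_cut c w -> shiftS sq p w = shiftS sq q w) -> p = q.
Proof.
move=> H; pose i1 : R[i] := 0 +i* 1; pose i2 : R[i] := 0 +i* 2.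
have c1 : ~ branch_cut c i1 by apply: nonreal_off; rewrite complex_real oner_eq0.
have c2 : ~ branch_cut c i2 by apply: nonreal_off; rewrite complex_real pnatr_eq0.
have E w : ~ branch_cut c w -> p.1 - q.1 = 2 * (p.2 - q.2) * rho sq w.
  move=> /H /invr_inj /(congr1 (fun z => z + w + 2 * p.2 * rho sq w - q.1)) h.
  have -> : p.1 - q.1 =
    p.1 - w - 2 * p.2 * rho sq w + w + 2 * p.2 * rho sq w - q.1 by ring.
  by rewrite h; ring.
have r12 : rho sq i1 != rho sq i2.
  apply/eqP => r12; have := char_rootE c_gt0 (rho_root sq_branch c1).
  rewrite r12 -(char_rootE c_gt0 (rho_root sq_branch c2)) => -[] /eqP.
  by rewrite eq_sym -subr_eq0 addrK oner_eq0.
have pq2 : p.2 - q.2 = 0.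
  have : 2 * (p.2 - q.2) * (rho sq i1 - rho sq i2) = 0.
    by rewrite mulrBr -E// -E// subrr.
  move/eqP; rewrite !mulf_eq0 pnatr_eq0 /= [_ - rho _ _ == 0]subr_eq0 (negPf r12).
  by rewrite orbF => /eqP.
have := E _ c1; rewrite pq2 mulr0 mul0r => /eqP; rewrite subr_eq0 => /eqP pq1.
move/eqP: pq2; rewrite subr_eq0 => /eqP pq2.
by case: p q pq1 pq2 {H E} => [p1 p2] [q1 q2] /= -> ->.
Qed.

(** A mixed choice has sum c / r + r^* = (c / |r|^2 + 1) r^*, so alpha is not real. The doubly outer
    choice has product c^2 / |r|^2 > c, so beta is negative. *)
Lemma extra_nonreal a b ra : a \isn't Num.real -> b = a^*%C -> inner_root c a ra ->
  positive_solution c a b (sol_pair c ra ra^*%C) /\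
  extra_solutions c a b (sol_pair c ra ra^*%C) = set0.
Proof.
move=> aN bE ara; have aroot := ara.1.
have broot : char_root c b ra^*%C by rewrite bE; exact: char_rootJ.
have r0 := char_root_neq0 c_gt0 aroot; have aE := char_rootE c_gt0 aroot.
have rc : sqnorm ra < c.
  have := inner_root_sqnorm c_gt0 ara; case: ifP => // /(edgeP c_gt0)[_ aR].
  by move: aN; rewrite aR.
have rr : ra * ra^*%C = (sqnorm ra)%:C by rewrite -sqnormE sqr_normc.
have s0 : 0 < sqnorm ra by rewrite sqnorm_gt0.
have sC : (sqnorm ra)%:C != 0 by rewrite (inj_eq (@complexI R) _ 0) gt_eqF.
have rJ : ra^*%C = (sqnorm ra)%:C / ra by rewrite -rr mulrAC divff ?mul1r.
have raN : ra \isn't Num.real.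
  apply: contra aN => /complex_realP[k kE]; apply/complex_realP.
  exists (- (k + c / k)); rewrite aE kE rmorphN rmorphD rmorphM fmorphV //.
have mixed r : r \isn't Num.real -> r != 0 -> c%:C / r + r^*%C \isn't Num.real.
  move=> rN rn0; have sr : 0 < sqnorm r by rewrite sqnorm_gt0.
  have -> : c%:C / r + r^*%C = (c / sqnorm r + 1)%:C * r^*%C.
    rewrite rmorphD rmorph1 rmorphM fmorphV /= -sqnormE sqr_normc.
    have rJ0 : r^*%C != 0 by rewrite conjc_eq0.
    by field; rewrite rn0 andbT; exact: rJ0.
  have k0 : 0 < c / sqnorm r + 1 by rewrite addr_gt0// divr_gt0.
  move: (_ + 1) k0 => k k0; case: r rN {rn0 sr} => u v; rewrite complex_real => v0.
  by rewrite complex_real /= mul0r addr0 mulf_eq0 oppr_eq0 negb_or v0 gt_eqF.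
split.
  apply/(positive_sol_pair c_gt0 aroot broot); split.
    by rewrite addcJ realM ?realn//; apply/complex_realP; eexists.
  by rewrite rr ltcR.
apply/seteqP; split => // p [/(positive_solutionE c_gt0 aroot broot)].
move=> [u [v [[->|->] [->|->] h1 h2 pE]]] pne.
- exact: (pne pE).
- have raJN : ra^*%C \isn't Num.real.
    by case: (ra) raN => u' v'; rewrite !complex_real oppr_eq0.
  by have := mixed _ raJN; rewrite conjc_eq0 conjcK addrC h1 => /(_ r0).
- by move: h1; rewrite (negPf (mixed _ raN r0)).
- move: h2; rewrite mulrACA -invfM rr -!rmorphM -fmorphV -rmorphM ltcR.
  by rewrite ltr_pdivrMr// ltr_pM2l// ltNge (ltW rc).
Qed.

End Assembly.

Theorem proposition6p4 (R : realType) (c : R) (a b : R[i]) (N : R)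
    (sq : R[i] -> R[i]) (mu : probability (measurableTypeR R) R)
    (c_gt0 : 0 < c)
    (ab_sum_real : a + b \is Num.real) (ab_prod_real : a * b \is Num.real)
    (N_neq0 : N != 0)
    (Q_gt0 : forall t : R, - halfwidth c < t < halfwidth c ->
               0 < Qpoly N a b t)
    (not_double_edge : ~ (a = b /\ edge c a))
    (sq_branch : sqrt_branch c sq)
    (mu_density : has_density c N a b mu) :
  exists p0 : R[i] * R[i],
    (* 1 *)
    [/\ [/\ positive_solution c a b p0,
            forall w, ~ branch_cut c w -> shiftS sq p0 w = stieltjes mu w
          & forall p, positive_solution c a b p ->
              (forall w, ~ branch_cut c w -> shiftS sq p w = stieltjes mu w) ->
              p = p0],
    (* 2 *)
        a \isn't Num.real -> b \isn't Num.real ->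
          extra_solutions c a b p0 = set0,
    (* 3, for distinct roots that are not end points of the cut *)
        a \is Num.real -> b \is Num.real ->
        a != b -> ~~ edge c a -> ~~ edge c b ->
          (0 < a * b -> (extra_solutions c a b p0 #= `I_1)%card) /\
          (a * b < 0 -> (extra_solutions c a b p0 #= `I_3)%card),
    (* 3, the degenerate positions of the real roots *)
        a \is Num.real -> b \is Num.real ->
        [\/ a = b, edge c a | edge c b] ->
          [/\ 0 < a * b -> extra_solutions c a b p0 = set0,
              a * b < 0 -> ~~ (edge c a && edge c b) ->
                (extra_solutions c a b p0 #= `I_1)%card
            & a * b < 0 -> edge c a && edge c b ->
                extra_solutions c a b p0 = set0]
    (* 4 *)
      & forall p, extra_solutions c a b p0 p ->
          exists nu : probability (measurableTypeR R) R,
            (forall w, w \isn't Num.real -> shiftS sq p w = stieltjes nu w) /\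
            has_atom nu].
Proof.
pose inner z := if pselect (branch_cut c z) then - z / 2 else rho sq z.
have innerP z : ~ branch_cut c z \/ edge c z -> inner_root c z (inner z).
  rewrite /inner; case: pselect => [zc [//|ze]|zc _].
    exact: edge_inner_root.
  exact: off_inner_root.
set ra := inner a; set rb := inner b.
have ara : inner_root c a ra by apply: innerP; apply: positive_root_off Q_gt0 _; left.
have brb : inner_root c b rb by apply: innerP; apply: positive_root_off Q_gt0 _; right.
have formula := stieltjes_formula c_gt0 ab_sum_real ab_prod_real N_neq0 Q_gt0
  mu_density sq_branch ara brb not_double_edge.
pose p0 := sol_pair c ra rb.
have shift0 w : ~ branch_cut c w -> shiftS sq p0 w = stieltjes mu w.
  move=> wc; rewrite (shiftS_sol_pair c_gt0 _ _ sq_branch wc) -(formula w wc).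
  (* The denominator cannot vanish, as the right side c rho(w) of [formula] is nonzero. *)
  rewrite mulfK//; apply/eqP => e0; have := formula w wc; rewrite e0 mulr0 => /esym/eqP.
  rewrite mulf_eq0 (negPf (cC_neq0 c_gt0)) /=.
  by rewrite (negPf (char_root_neq0 c_gt0 (rho_root sq_branch wc))).
have unique p : positive_solution c a b p ->
    (forall w, ~ branch_cut c w -> shiftS sq p w = stieltjes mu w) -> p = p0.
  by move=> _ H; apply: (shiftS_inj c_gt0 sq_branch) => w wc; rewrite H// shift0.
exists p0; have [aR|aN] := boolP (a \is Num.real); last first.
  have bE := conj_roots ab_sum_real ab_prod_real aN.
  have rbE : rb = ra^*%C.
    have := char_rootJ ara.1; rewrite -bE => rJ.
    have nonedge z : z \isn't Num.real -> ~~ edge c z.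
      by apply: contra => /(edgeP c_gt0)[].
    have bN : b \isn't Num.real.
      by move: aN; rewrite bE; case: (a) => u v; rewrite !complex_real oppr_eq0.
    have := inner_root_sqnorm c_gt0 ara; rewrite (negPf (nonedge _ aN)) => rac.
    have := inner_root_sqnorm c_gt0 brb; rewrite (negPf (nonedge _ bN)) => rbc.
    by apply/esym; apply: (inner_root_unique c_gt0 brb.1 rJ rbc); rewrite sqnormJ.
  have [pos0 extra0] := extra_nonreal c_gt0 aN bE ara.
  rewrite /p0 rbE; rewrite /p0 rbE in shift0 unique.
  split => //; first by move=> p; rewrite extra0.
have bR : b \is Num.real by rewrite -[b](addKr a) realD ?realN.
have /complex_realP[x xE] := inner_root_real c_gt0 aR ara.
have /complex_realP[y yE] := inner_root_real c_gt0 bR brb.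
have ax : char_root c a x%:C by rewrite -xE; exact: ara.1.
have bY : char_root c b y%:C by rewrite -yE; exact: brb.1.
have sqn (u : R) : sqnorm u%:C = u ^+ 2 by rewrite /sqnorm /= expr0n addr0.
have realN0 (u : R) z : char_root c z u%:C -> u != 0.
  by move=> /(char_root_neq0 c_gt0); rewrite (inj_eq (@complexI R) u 0).
have x0 := realN0 _ _ ax; have y0 := realN0 _ _ bY.
have edgeE z (u : R) : inner_root c z u%:C ->
    u ^+ 2 <= c /\ (edge c z = (u ^+ 2 == c)).
  move=> /(inner_root_sqnorm c_gt0); rewrite sqn; case: ifP => _ h.
    by rewrite h eqxx.
  by rewrite ltW// lt_eqF.
have [xc aeE] : x ^+ 2 <= c /\ (edge c a = (x ^+ 2 == c)) by apply: edgeE; rewrite -xE.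
have [yc beE] : y ^+ 2 <= c /\ (edge c b = (y ^+ 2 == c)) by apply: edgeE; rewrite -yE.
have abE : (a == b) = (x == y).
  apply/eqP/eqP => [ab|xy].
    have : inner a = inner b by rewrite ab.
    by rewrite -/ra -/rb xE yE => /complexI.
  by rewrite (char_rootE c_gt0 ax) (char_rootE c_gt0 bY) xy.
have corner : ~ (x = y /\ x ^+ 2 = c).
  move=> [xy xx]; apply: not_double_edge; split; first by apply/eqP; rewrite abE xy.
  by rewrite aeE xx.
have xy_lt := real_pos_main xc yc corner.
have xy0 : x * y != 0 by rewrite mulf_neq0.
(* Since x^2 + c and y^2 + c are positive, a b and x y have the same sign, which turns the
   hypotheses on a b into hypotheses on x y. *)
have prodE : a * b = ((x ^+ 2 + c) * (y ^+ 2 + c) / (x * y))%:C.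
  have xC : x%:C != 0 by rewrite (inj_eq (@complexI R) x 0).
  have yC : y%:C != 0 by rewrite (inj_eq (@complexI R) y 0).
  rewrite (char_rootE c_gt0 ax) (char_rootE c_gt0 bY).
  rewrite !(rmorphM, rmorphD, rmorphXn, fmorphV) /=.
  by field; rewrite xC yC.
have pos : 0 < (x ^+ 2 + c) * (y ^+ 2 + c).
  by rewrite mulr_gt0// ltr_wpDl ?sqr_ge0.
have ab_pos : 0 < a * b -> 0 < x * y.
  by rewrite prodE ltcR pmulr_rgt0// invr_gt0.
have ab_neg : a * b < 0 -> x * y < 0.
  by rewrite prodE ltcR pmulr_rlt0// invr_lt0.
have p0E : p0 = sol_pair c x%:C y%:C by rewrite /p0 xE yE.
have pos0 : positive_solution c a b p0.
  rewrite p0E; apply/(positive_sol_pair c_gt0 ax bY); split.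
    by rewrite -rmorphD; apply/complex_realP; exists (x + y).
  by rewrite -rmorphM ltcR.
rewrite p0E in shift0 unique pos0 *.
split=> //.
- move=> _ _; rewrite abE aeE beE => xy xe ye; split=> [/ab_pos|/ab_neg] h.
    exact: card_extra_pos.
  exact: card_extra_neg.
- move=> _ _ deg.
  have degR : [\/ x = y, x ^+ 2 = c | y ^+ 2 = c].
    by case: deg => [/eqP||]; rewrite ?abE ?aeE ?beE => /eqP;
      [constructor 1|constructor 2|constructor 3].
  split=> [/ab_pos h|/ab_neg h|/ab_neg h]; rewrite ?aeE ?beE.
  + exact: extra_pos_degenerate.
  + rewrite negb_and; case: degR => [xy|xe|ye].
    * by move: h; rewrite xy -expr2 ltNge sqr_ge0.
    * by rewrite xe eqxx /= => ye; exact: extra_neg_edgel.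
    * by rewrite ye eqxx /= orbF => xe; exact: extra_neg_edger.
  + by move=> /andP[/eqP xe /eqP ye]; exact: extra_neg_edges.
- have formula' w : ~ branch_cut c w ->
     stieltjes mu w * ((c%:C - x%:C * rho sq w) * (c%:C - y%:C * rho sq w)) =
     c%:C * rho sq w by move=> wc; rewrite -xE -yE formula.
  have formula'' w : ~ branch_cut c w ->
     stieltjes mu w * ((c%:C - y%:C * rho sq w) * (c%:C - x%:C * rho sq w)) =
     c%:C * rho sq w by move=> wc; rewrite [_ * (c%:C - x%:C * _)]mulrC formula'.
  have rinv (u : R) : (c / u)%:C = c%:C / u%:C by rewrite rmorphM fmorphV.
  have einv (u : R) : u != 0 -> u ^+ 2 = c -> c / u = u.
    by move=> u0 <-; rewrite expr2 mulfK.
  have one10 : x * y < x ^+ 2 -> sol_pair c (c / x)%:C y%:C <> sol_pair c x%:C y%:C ->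
    exists nu : probability (measurableTypeR R) R,
      (forall w, w \isn't Num.real ->
        shiftS sq (sol_pair c (c / x)%:C y%:C) w = stieltjes nu w) /\ has_atom nu.
    move=> h ne; rewrite rinv; apply: (atomic_one c_gt0 sq_branch formula') => //.
    by rewrite lt_neqAle xc andbT; apply/eqP => xe; apply: ne; rewrite einv.
  have one01 : x * y < y ^+ 2 -> sol_pair c x%:C (c / y)%:C <> sol_pair c x%:C y%:C ->
    exists nu : probability (measurableTypeR R) R,
      (forall w, w \isn't Num.real ->
        shiftS sq (sol_pair c x%:C (c / y)%:C) w = stieltjes nu w) /\ has_atom nu.
    move=> h ne; rewrite sol_pairC rinv.
    apply: (atomic_one c_gt0 sq_branch formula'') => //; rewrite 1?[y * x]mulrC//.
    by rewrite lt_neqAle yc andbT; apply/eqP => ye; apply: ne; rewrite einv.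
  move=> p /(extra_realP c_gt0 x0 y0 ax bY)[pne [[pE h]|[pE h]|[pE h]]];
    rewrite pE in pne *.
  + exact: one10.
  + exact: one01.
  (* Exchanging both roots is admissible only if x y < 0 or x y > c, and the latter is ruled out by
     [xy_lt]. *)
  + have xy_neg : x * y < 0.
      rewrite lt_neqAle xy0 /= leNgt; apply/negP => xyp.
      by move: h; rewrite expr2 ltr_pM2r// ltNge (ltW xy_lt).
    (* At an end point the exchange is trivial, so the pair is a single exchange and one atom
       suffices. *)
    have [xe|xe] := eqVneq (x ^+ 2) c.
      rewrite (einv x)// in pne *; apply: one01 => //.
      by rewrite (lt_le_trans xy_neg)// sqr_ge0.
    have [ye|ye] := eqVneq (y ^+ 2) c.
      rewrite (einv y)// in pne *; apply: one10 => //.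
      by rewrite (lt_le_trans xy_neg)// sqr_ge0.
    rewrite !rinv; apply: (atomic_two c_gt0 sq_branch formula') => //.
    - by rewrite lt_neqAle xe.
    - by rewrite lt_neqAle ye.
Qed.
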